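(* Assume $\mu$ is irreducible. For every $s\in I_\mu$, there exist $A_s\ge0$ and $B_s\ge0$ such that for every $\varphi\in C^\alpha(\mathrm{P}(\mathbb{C}^d),\mathbb{C})$ and every $n\ge1$, $$\|Q_s^n\varphi\|_\alpha\le A_s\|\varphi\|_\infty+B_s\,h_\alpha(n)\,\|\varphi\|_\alpha,$$ where $$h_\alpha(n)=\frac{1}{k(s)^n}\int_{M_d(\mathbb{C})^n}\|\wedge^2(v_n\cdots v_1)\|^\alpha\,\|v_n\cdots v_1\|^{s-2\alpha}\,d\mu^{\otimes n}(v_1,\dots,v_n).$$
   Context: $d\ge1$; $\|\cdot\|$ is the Euclidean norm on $\mathbb{C}^d$ and the induced operator norm on $M_d(\mathbb{C})$. $\mu$ is a Borel measure on $M_d(\mathbb{C})$; $0<s_-<s_+\le+\infty$, $\int\|v\|^sd\mu(v)<\infty$ for every finite $s\in[s_-,s_+]$, $I_\mu=(s_-,s_+)$, $\alpha=\min\{s_-/3,1\}$. $\mu$ is irreducible if no linear subspace $F$ with $\{0\}\ne F\ne\mathbb{C}^d$ satisfies $vF\subset F$ for all $v\in\operatorname{supp}\mu$. $\wedge^2A$ is the linear map on $\wedge^2\mathbb{C}^d$ with $\wedge^2A(x_1\wedge x_2)=Ax_1\wedge Ax_2$, and $\|\wedge^2A\|$ is its operator norm for the Hermitian inner product $\langle x_1\wedge x_2,y_1\wedge y_2\rangle=\det(\langle x_i,y_j\rangle)_{i,j=1}^2$. $\mathrm{P}(\mathbb{C}^d)$ is the projective space with metric $d(\hat x,\hat y)=\sqrt{1-|\langle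 x,y\rangle|^2}$, $x,y$ unit representatives; $v\cdot\hat x$ is the class of $vx$ when $vx\neq0$; expressions $f(v\cdot\hat x)\|vx\|^s$ are $0$ when $vx=0$. $C^\alpha(\mathrm{P}(\mathbb{C}^d),\mathbb{C})$ is the Banach space of $\alpha$-Hölder functions with norm $\|f\|_\alpha=\|f\|_\infty+m_\alpha(f)$, $m_\alpha(f)=\sup_{\hat x\ne\hat y}|f(\hat x)-f(\hat y)|/d(\hat x,\hat y)^\alpha$. For $s\in I_\mu$: $\Gamma_sf(\hat x)=\int f(v\cdot\hat x)\|vx\|^sd\mu(v)$; $k(s)=\lim_{n}\left(\int\|v_n\cdots v_1\|^sd\mu^{\otimes n}\right)^{1/n}>0$; $e_s:\mathrm{P}(\mathbb{C}^d)\to\mathbb{R}_+$ is a fixed strictly positive $\min\{1,s/2\}$-Hölder function with $\Gamma_se_s=k(s)e_s$ (such a function exists when $\mu$ is irreducible); and $Q_s$ is the Markov operator $$Q_sf(\hat x)=\frac{1}{k(s)e_s(\hat x)}\int_{M_d(\mathbb{C})}f(v\cdot\hat x)e_s(v\cdot\hat x)\|vx\|^sd\mu(v).$$ *)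

(* Defs.v *)
From HB Require Import structures.
From mathcomp Require Import all_boot all_order all_algebra complex.
From mathcomp Require Import all_classical all_reals all_analysis.

Set Implicit Arguments.
Unset Strict Implicit.
Unset Printing Implicit Defensive.

Import Order.TTheory GRing.Theory Num.Theory.
Import numFieldNormedType.Exports.

Local Open Scope classical_set_scope.
Local Open Scope ring_scope.
Local Open Scope complex_scope.

(* [R[i]] carries its modulus both as [`|z| : R[i]] and as [normc z : R]; all
   the norms below are R-valued, hence the latter. *)
Notation cmod := ComplexField.Normc.normc.

Definition hdot (R : realType) (d : nat) (x y : 'cV[R[i]]_d) : R[i] :=
  \sum_(i < d) x i 0 * (y i 0)^*.

Definition enorm (R : realType) (d : nat) (x : 'cV[R[i]]_d) : R :=
  Num.sqrt (\sum_(i < d) cmod (x i 0) ^+ 2).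

Definition opnorm (R : realType) (d : nat) (A : 'M[R[i]]_d) : R :=
  sup [set enorm (A *m x) | x in [set x : 'cV[R[i]]_d | enorm x <= 1]].

(* wedge^2 C^d is realized as the space of alternating tensors, i.e. of
   skew-symmetric d x d matrices. In this model wedge^2 A is X |-> A X A^T, and
   the factor 1/2 in [wdot] is what makes [wdot_wedge] hold. *)
Definition wedge (R : realType) (d : nat) (x y : 'cV[R[i]]_d) : 'M[R[i]]_d :=
  x *m y^T - y *m x^T.

Definition wedge2_space (R : realType) (d : nat) : set 'M[R[i]]_d :=
  [set X | X^T = - X].

Definition wdot (R : realType) (d : nat) (X Y : 'M[R[i]]_d) : R[i] :=
  2%:R^-1 * \sum_(i < d) \sum_(j < d) X i j * (Y i j)^*.

Definition wnorm (R : realType) (d : nat) (X : 'M[R[i]]_d) : R :=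
  Num.sqrt (complex.Re (wdot X X)).

Definition wedge2 (R : realType) (d : nat) (A X : 'M[R[i]]_d) : 'M[R[i]]_d :=
  A *m X *m A^T.

Definition wedge2_norm (R : realType) (d : nat) (A : 'M[R[i]]_d) : R :=
  sup [set wnorm (wedge2 A X) |
         X in [set X : 'M[R[i]]_d | wedge2_space X /\ wnorm X <= 1]].

Lemma wedge_in_space (R : realType) (d : nat) (x y : 'cV[R[i]]_d) :
  wedge2_space (wedge x y).
Proof.
by rewrite /wedge2_space /wedge /= linearB /= !trmx_mul !trmxK opprB.
Qed.

Lemma wedge_span (R : realType) (d : nat) (X : 'M[R[i]]_d) :
  wedge2_space X ->
  X = \sum_(i < d) \sum_(j < d)
        (2%:R^-1 * X i j) *: wedge (delta_mx i 0) (delta_mx j 0).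
Proof.
move=> skX; have X_tr i j : X j i = - X i j.
  by have := congr1 (fun M : 'M[R[i]]_d => M i j) skX; rewrite !mxE.
have wE i j : wedge (delta_mx i 0) (delta_mx j 0)
    = delta_mx i j - delta_mx j i :> 'M[R[i]]_d.
  by rewrite /wedge !trmx_delta !mul_delta_mx.
under eq_bigr do under eq_bigr do rewrite wE scalerBr.
under eq_bigr do rewrite big_split /=.
rewrite big_split /= [X in _ + X]exchange_big /= -big_split /=.
rewrite [LHS]matrix_sum_delta; apply: eq_bigr => i _.
rewrite -big_split /=; apply: eq_bigr => j _.
rewrite -scalerBl; congr (_ *: _).
by rewrite (X_tr i j) mulrN opprK -mulrDl -[2%:R^-1]div1r -splitr mul1r.
Qed.

Lemma wedge2_wedge (R : realType) (d : nat) (A : 'M[R[i]]_d)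
    (x y : 'cV[R[i]]_d) :
  wedge2 A (wedge x y) = wedge (A *m x) (A *m y).
Proof.
by rewrite /wedge2 /wedge mulmxBr mulmxBl !trmx_mul !mulmxA.
Qed.

Lemma wdot_wedge (R : realType) (d : nat) (x y : 'I_2 -> 'cV[R[i]]_d) :
  wdot (wedge (x 0) (x 1)) (wedge (y 0) (y 1)) =
  \det (\matrix_(i < 2, j < 2) hdot (x i) (y j)).
Proof.
rewrite (expand_det_row _ 0) !big_ord_recl big_ord0 addr0 /cofactor !det_mx11.
rewrite !mxE /= expr0 mul1r expr1 mulN1r mulrN /wdot.
have [-> ->] : lift 0 0 = 1 :> 'I_2 /\ lift 1 0 = 0 :> 'I_2.
  by split; apply/val_inj.
have E (a b a' b' : 'cV[R[i]]_d) : \sum_(i < d) \sum_(j < d)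
    (a i 0 * b j 0) * (a' i 0 * b' j 0)^* =
    hdot a a' * hdot b b'.
  rewrite /hdot mulr_suml; apply: eq_bigr => i _.
  rewrite mulr_sumr; apply: eq_bigr => j _.
  by rewrite rmorphM mulrACA.
have -> : \sum_(i < d) \sum_(j < d)
    wedge (x 0) (x 1) i j * (wedge (y 0) (y 1) i j)^* =
    (hdot (x 0) (y 0) * hdot (x 1) (y 1)
     - hdot (x 0) (y 1) * hdot (x 1) (y 0)) *+ 2.
  have tE (a b : 'cV[R[i]]_d) i j : wedge a b i j
      = a i 0 * b j 0 - b i 0 * a j 0.
    by rewrite !mxE !big_ord1 !mxE.
  transitivity (\sum_(i < d) \sum_(j < d)
     ((x 0 i 0 * x 1 j 0) * (y 0 i 0 * y 1 j 0)^*
      - (x 0 i 0 * x 1 j 0) * (y 1 i 0 * y 0 j 0)^*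
      + ((x 1 i 0 * x 0 j 0) * (y 1 i 0 * y 0 j 0)^*
         - (x 1 i 0 * x 0 j 0) * (y 0 i 0 * y 1 j 0)^*))).
    apply: eq_bigr => i _; apply: eq_bigr => j _.
    by rewrite !tE rmorphB /= mulrBl !mulrBr opprB.
  under eq_bigr do rewrite big_split /= !sumrB.
  rewrite big_split /= !sumrB !E mulr2n; congr (_ + _).
  by rewrite [hdot (x 1) (y 1) * _]mulrC [hdot (x 1) (y 0) * _]mulrC.
by rewrite -[X in _ * X]mulr_natl mulKf ?pnatr_eq0.
Qed.

Definition pspace (R : realType) (d : nat) : Type :=
  {L : {vspace 'cV[R[i]]_d} | \dim L == 1%N}.

Definition urep (R : realType) (d : nat) (L : pspace R d) : 'cV[R[i]]_d :=
  ((enorm (vpick (val L)))^-1)%:C *: vpick (val L).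

Definition pdist (R : realType) (d : nat) (x y : pspace R d) : R :=
  Num.sqrt (1 - cmod (hdot (urep x) (urep y)) ^+ 2).

(* [None] exactly when [v *m urep x = 0], as then the span is 0-dimensional. *)
Definition pact (R : realType) (d : nat) (v : 'M[R[i]]_d) (x : pspace R d) :
    option (pspace R d) :=
  insub <[v *m urep x]>%VS.

Definition supnorm (R : realType) (d : nat) (f : pspace R d -> R[i]) : \bar R :=
  ereal_sup [set (cmod (f x))%:E | x in [set: pspace R d]].

(* The 0 only matters for d = 1, where there is no pair x != y and
   [ereal_sup set0] would be -oo. *)
Definition hsemi (R : realType) (d : nat) (a : R) (f : pspace R d -> R[i]) :
    \bar R :=
  ereal_sup (0%E |` [set (cmod (f p.1 - f p.2) / pdist p.1 p.2 `^ a)%:E |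
                      p in [set p : pspace R d * pspace R d | p.1 != p.2]]).

Definition hnorm (R : realType) (d : nat) (a : R) (f : pspace R d -> R[i]) :
    \bar R :=
  (supnorm f + hsemi a f)%E.

Definition holder (R : realType) (d : nat) (a : R) (f : pspace R d -> R[i]) :
    Prop :=
  (hnorm a f < +oo)%E.

Notation Mborel R d := (g_sigma_algebraType (@open 'M[R[i]^o]_d)).

Definition msupp (R : realType) (d : nat)
    (mu : {measure set (Mborel R d) -> \bar R}) : set 'M[R[i]]_d :=
  [set v | forall U : set 'M[R[i]^o]_d, open U -> U v -> (0 < mu U)%E].

Definition irreducible (R : realType) (d : nat)
    (mu : {measure set (Mborel R d) -> \bar R}) : Prop :=
  ~ exists F : {vspace 'cV[R[i]]_d},
      [/\ F <> 0%VS, F <> fullv &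
          forall v, msupp mu v -> forall x, x \in F -> v *m x \in F].

(* mu^{(x) n}, as a set function on n-tuples (v_1, ..., v_n). No sigma-finiteness
   of mu is assumed, so that mu({0}) = +oo remains possible. *)
Fixpoint mpower (R : realType) (d : nat)
    (mu : {measure set (Mborel R d) -> \bar R}) (n : nat) :
    set (n.-tuple (Mborel R d)) -> \bar R :=
  match n with
  | 0 => fun A => \d_([tuple] : 0.-tuple (Mborel R d)) A
  | m.+1 =>
      pushforward (mu \x @mpower R d mu m)%E
        (fun p : Mborel R d * m.-tuple (Mborel R d) =>
           [tuple of p.1 :: p.2] : m.+1.-tuple (Mborel R d))
  end.
Arguments mpower {R d} mu n _.

(* v_n ... v_1 *)
Definition mprod (R : realType) (d n : nat) (v : n.-tuple 'M[R[i]]_d) :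
    'M[R[i]]_d :=
  foldl (fun w u => u *m w) 1%:M v.

Definition cintegral (R : realType) (d : nat)
    (mu : {measure set (Mborel R d) -> \bar R}) (f : 'M[R[i]]_d -> R[i]) :
    R[i] :=
  (\int[mu]_v complex.Re (f v)) +i* (\int[mu]_v complex.Im (f v)).

Definition Gamma (R : realType) (d : nat)
    (mu : {measure set (Mborel R d) -> \bar R}) (s : R)
    (f : pspace R d -> R[i]) : pspace R d -> R[i] :=
  fun x => cintegral mu (fun v =>
    if pact v x is Some y then f y * (enorm (v *m urep x) `^ s)%:C else 0).

Definition kfun (R : realType) (d : nat)
    (mu : {measure set (Mborel R d) -> \bar R}) (s : R) : R :=
  limn (fun n : nat =>
    fine (\int[mpower mu n]_v (opnorm (mprod v) `^ s)%:E) `^ (n%:R^-1)).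

Definition Qop (R : realType) (d : nat)
    (mu : {measure set (Mborel R d) -> \bar R}) (s : R)
    (e : pspace R d -> R) (f : pspace R d -> R[i]) : pspace R d -> R[i] :=
  fun x => (kfun mu s * e x)^-1%:C * cintegral mu (fun v =>
    if pact v x is Some y
    then f y * (e y)%:C * (enorm (v *m urep x) `^ s)%:C else 0).

Definition hfun (R : realType) (d : nat)
    (mu : {measure set (Mborel R d) -> \bar R}) (s a : R) (n : nat) : \bar R :=
  ((kfun mu s ^+ n)^-1%:E *
   \int[mpower mu n]_v
      (wedge2_norm (mprod v) `^ a * opnorm (mprod v) `^ (s - 2 * a))%:E)%E.

(* Main.v *)
Require Import Defs.
From HB Require Import structures.
From mathcomp Require Import all_boot all_order all_algebra complex.
From mathcomp Require Import all_classical all_reals all_analysis.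
From mathcomp Require Import measurable_realfun kernel ring lra.

Import Order.TTheory GRing.Theory Num.Theory.
Import numFieldNormedType.Exports.

Local Open Scope classical_set_scope.
Local Open Scope ring_scope.
Local Open Scope complex_scope.

(** A function f on P(C^d) is replaced by its s-homogeneous extension
    F(X) = f([X]) |X|^s to C^d, so that Gamma_s becomes F |-> int F(v X) dmu(v)
    and its n-th iterate an integral over the products w = v_n ... v_1.
    For f Hoelder and |X| = |Y| = 1, the identity
    |wX /\ wY| = |wX| |wY| d(w.X, w.Y) and |wX /\ wY| <= |wedge^2 w| d(X, Y) give
    |F(wX) - F(wY)| <= (C |f|_a |wedge^2 w|^a |w|^(s-2a) + C |f|_oo |w|^s) d(X, Y)^a;
    here the difference f(w.X) - f(w.Y) is weighted with the smaller of |wX|^s and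
    |wY|^s, so that no negative power of a norm appears.
    Integrating, the first term produces h_a(n). For the second one, e_s is bounded
    below by compactness, so int |w|^s is controlled by the sum over a basis of
    int |w e_j|^s <= C Gamma_s^n e_s, which grows like k(s)^n.
    The case n = 1 also shows that Gamma_s preserves Hoelder functions, which
    settles all measurability and integrability questions for the iterates.
    Since Q_s acts separately on real and imaginary parts, it is enough to treat
    real functions. *)

(** * Hermitian norms *)

Section hermitian.
Context {R : realType} {d : nat}.
Implicit Types (x y w : 'cV[R[i]]_d) (A X Y : 'M[R[i]]_d) (z : R[i]).

(** The exponent a = min(s_-/3, 1) enters in two ways. Since s > s_-, one has 3a < s, so s - a and s
    - 2a are positive and all powers of norms that occur are increasing. Also a <= min(1, s/2), so
    the given regularity of e_s implies a-Hoelder regularity. Applying a one-step Hoelder bound n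
    times would produce an n-fold product of one-step constants in place of h_a(n). Hence the
    pointwise estimate is made only once, for the initial function and an arbitrary product w, and
    [iter_transfer_dist] carries it through the n integrals; Hoelder bounds of the iterates are used
    only qualitatively. Extending by 0 at the origin keeps the matrices with vX = 0 out of this
    induction. A finite s-moment allows mu to have infinite mass near 0 and even at 0, which is why
    the product measures are handled as compositions of s-finite kernels. *)

Lemma cmod_norm z : `|z| = (cmod z)%:C.
Proof. by rewrite normc_def; case: z. Qed.

Lemma cmod_ge0 z : 0 <= cmod z.
Proof. by case: z => a b; exact: sqrtr_ge0. Qed.

Lemma cmodC (a : R) : cmod a%:C = `|a|.
Proof. by rewrite /= expr0n /= addr0 sqrtr_sqr. Qed.

Lemma sqr_cmod z : (cmod z ^+ 2)%:C = z * z^*.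
Proof. by rewrite rmorphXn /= -cmod_norm sqr_normc. Qed.

Lemma enorm_ge0 x : 0 <= enorm x.
Proof. exact: sqrtr_ge0. Qed.

Lemma sqr_enorm x : enorm x ^+ 2 = \sum_(i < d) cmod (x i 0) ^+ 2.
Proof. by rewrite sqr_sqrtr// sumr_ge0// => i _; exact: sqr_ge0. Qed.

Lemma hdotxx x : hdot x x = (enorm x ^+ 2)%:C.
Proof.
rewrite sqr_enorm raddf_sum; apply: eq_bigr => i _.
by rewrite /= sqr_cmod.
Qed.

Lemma hdotC x y : hdot y x = (hdot x y)^*.
Proof.
rewrite /hdot raddf_sum; apply: eq_bigr => i _.
by rewrite /= rmorphM /= conjcK mulrC.
Qed.

Lemma hdotDl x y w : hdot (x + y) w = hdot x w + hdot y w.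
Proof.
by rewrite /hdot -big_split /=; apply: eq_bigr => i _; rewrite mxE mulrDl.
Qed.

Lemma hdotZl z x y : hdot (z *: x) y = z * hdot x y.
Proof.
by rewrite /hdot mulr_sumr; apply: eq_bigr => i _; rewrite mxE mulrA.
Qed.

Lemma hdotDr x y w : hdot w (x + y) = hdot w x + hdot w y.
Proof. by rewrite hdotC hdotDl raddfD /= -!hdotC. Qed.

Lemma hdotZr z x y : hdot x (z *: y) = z^* * hdot x y.
Proof. by rewrite hdotC hdotZl rmorphM /= -hdotC. Qed.

Lemma wdotXX X :
  wdot X X = (2^-1 * \sum_i \sum_j cmod (X i j) ^+ 2)%:C.
Proof.
rewrite /wdot rmorphM /= fmorphV /= rmorphD /= rmorph1; congr (_ * _).
rewrite raddf_sum; apply: eq_bigr => i _.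
by rewrite /= raddf_sum; apply: eq_bigr => j _; rewrite /= sqr_cmod.
Qed.

Lemma sqr_wnorm X : wnorm X ^+ 2 = 2^-1 * \sum_i \sum_j cmod (X i j) ^+ 2.
Proof.
rewrite /wnorm wdotXX /= sqr_sqrtr// mulr_ge0 ?invr_ge0 ?ler0n//.
by rewrite sumr_ge0 // => i _; rewrite sumr_ge0 // => j _; exact: sqr_ge0.
Qed.

Lemma wnorm_ge0 X : 0 <= wnorm X.
Proof. exact: sqrtr_ge0. Qed.

Lemma wdot_sqr X : wdot X X = (wnorm X ^+ 2)%:C.
Proof. by rewrite wdotXX sqr_wnorm. Qed.

(* Lagrange's identity. *)
Lemma sqr_wnorm_wedge x y :
  wnorm (wedge x y) ^+ 2 = enorm x ^+ 2 * enorm y ^+ 2 - cmod (hdot x y) ^+ 2.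
Proof.
apply: complexI; rewrite -wdot_sqr.
pose p (i : 'I_2) := if i == 0 then x else y.
have := wdot_wedge p p; rewrite {1 2}/p /= => ->.
rewrite (expand_det_row _ 0) !big_ord_recl big_ord0 addr0 /cofactor !det_mx11.
rewrite !mxE /= expr0 mul1r expr1 mulN1r mulrN.
have [-> ->] : lift 0 0 = 1 :> 'I_2 /\ lift 1 0 = 0 :> 'I_2.
  by split; apply/val_inj.
by rewrite /p /= rmorphB rmorphM /= sqr_cmod -!hdotxx (hdotC x y).
Qed.

Lemma cauchy_schwarz x y : cmod (hdot x y) <= enorm x * enorm y.
Proof.
rewrite -(@ler_pXn2r _ 2)// ?nnegrE ?cmod_ge0 ?mulr_ge0 ?enorm_ge0//.
by rewrite exprMn -subr_ge0 -sqr_wnorm_wedge sqr_ge0.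
Qed.

Lemma wnorm_wedge_le x y : wnorm (wedge x y) <= enorm x * enorm y.
Proof.
rewrite -(@ler_pXn2r _ 2)// ?nnegrE ?wnorm_ge0 ?mulr_ge0 ?enorm_ge0//.
by rewrite exprMn sqr_wnorm_wedge gerBl sqr_ge0.
Qed.

Lemma Re_le_cmod z : complex.Re z <= cmod z.
Proof.
case: z => a b /=; apply: (le_trans (ler_norm a)).
by rewrite -sqrtr_sqr ler_wsqrtr// lerDl sqr_ge0.
Qed.

Lemma Re_cmod z : `|complex.Re z| <= cmod z.
Proof. by case: z => a b /=; rewrite -sqrtr_sqr ler_wsqrtr// lerDl sqr_ge0. Qed.

Lemma Im_cmod z : `|complex.Im z| <= cmod z.
Proof. by case: z => a b /=; rewrite -sqrtr_sqr ler_wsqrtr// lerDr sqr_ge0. Qed.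

Lemma cmod_ReIm z : cmod z <= `|complex.Re z| + `|complex.Im z|.
Proof.
case: z => a b /=.
rewrite -(@ler_pXn2r _ 2)// ?nnegrE ?sqrtr_ge0 ?addr_ge0 ?normr_ge0//.
rewrite sqr_sqrtr ?addr_ge0 ?sqr_ge0// sqrrD !real_normK ?num_real//.
by rewrite addrAC lerDl mulrn_wge0 ?mulr_ge0.
Qed.

Lemma sqr_enormD x y :
  enorm (x + y) ^+ 2 = enorm x ^+ 2 + enorm y ^+ 2 + 2 * complex.Re (hdot x y).
Proof.
have E : (2 * complex.Re (hdot x y))%:C = hdot x y + (hdot x y)^*.
  by rewrite addcJ rmorphM /= rmorph_nat.
apply: complexI; rewrite -hdotxx hdotDl !hdotDr (hdotC x y) !hdotxx !rmorphD.
by rewrite /= E; ring.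
Qed.

Lemma enormD x y : enorm (x + y) <= enorm x + enorm y.
Proof.
rewrite -(@ler_pXn2r _ 2)// ?nnegrE ?addr_ge0 ?enorm_ge0//.
rewrite sqr_enormD sqrrD [leRHS]addrAC lerD2l -[leRHS]mulr_natl.
apply: ler_wpM2l => //.
exact: le_trans (Re_le_cmod _) (cauchy_schwarz _ _).
Qed.

Lemma enormZ z x : enorm (z *: x) = cmod z * enorm x.
Proof.
apply/eqP; rewrite -(@eqrXn2 _ 2)// ?mulr_ge0 ?cmod_ge0 ?enorm_ge0//.
apply/eqP; apply: complexI; rewrite -hdotxx hdotZl hdotZr exprMn rmorphM /=.
by rewrite sqr_cmod -hdotxx mulrA.
Qed.

Lemma enorm0 : enorm (0 : 'cV[R[i]]_d) = 0.
Proof. by rewrite -(scale0r 0) enormZ ComplexField.Normc.normc0 mul0r. Qed.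

Lemma enormN x : enorm (- x) = enorm x.
Proof. by rewrite -scaleN1r enormZ normcN ComplexField.Normc.normc1 mul1r. Qed.

Lemma enormBC x y : enorm (x - y) = enorm (y - x).
Proof. by rewrite -enormN opprB. Qed.

Lemma enormB_le x y : `|enorm x - enorm y| <= enorm (x - y).
Proof.
rewrite ler_norml; apply/andP; split.
  rewrite lerNl opprB lerBlDr enormBC.
  by have := enormD (y - x) x; rewrite subrK.
by rewrite lerBlDr; have := enormD (x - y) y; rewrite subrK.
Qed.

Lemma cmod_le_enorm x (i : 'I_d) : cmod (x i 0) <= enorm x.
Proof.
rewrite -(@ler_pXn2r _ 2)// ?nnegrE ?cmod_ge0 ?enorm_ge0// sqr_enorm.
by rewrite (bigD1 i)//= lerDl sumr_ge0// => j _; exact: sqr_ge0.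
Qed.

Lemma enorm_sum (I : finType) (F : I -> 'cV[R[i]]_d) :
  enorm (\sum_i F i) <= \sum_i enorm (F i).
Proof.
elim/big_rec2: _ => [|i y1 y2 _ h]; first by rewrite enorm0.
exact: le_trans (enormD _ _) (lerD _ _).
Qed.

Lemma enorm_eq0 x : (enorm x == 0) = (x == 0).
Proof.
apply/eqP/eqP => [x0|->]; last exact: enorm0.
apply/matrixP => i j; rewrite ord1 mxE; apply: ComplexField.Normc.eq0_normc.
by apply/eqP; rewrite eq_le cmod_ge0 andbT -x0 cmod_le_enorm.
Qed.

Lemma enorm_gt0 x : (0 < enorm x) = (x != 0).
Proof. by rewrite lt_neqAle enorm_ge0 andbT eq_sym enorm_eq0. Qed.

Lemma enorm_le_sum x : enorm x <= \sum_i cmod (x i 0).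
Proof.
rewrite -(@ler_pXn2r _ 2)// ?nnegrE ?sumr_ge0 ?enorm_ge0//; last first.
  by move=> i _; exact: cmod_ge0.
rewrite sqr_enorm expr2 mulr_suml; apply: ler_sum => i _; rewrite expr2.
rewrite ler_wpM2l ?cmod_ge0// (bigD1 i)//= lerDl sumr_ge0// => j _.
exact: cmod_ge0.
Qed.

Lemma mulmx_cols A x : A *m x = \sum_j x j 0 *: col j A.
Proof.
apply/matrixP => i k; rewrite ord1 mxE summxE; apply: eq_bigr => j _.
by rewrite !mxE mulrC.
Qed.

Lemma enorm_mul_cols A x :
  enorm (A *m x) <= (\sum_j enorm (col j A)) * enorm x.
Proof.
rewrite mulmx_cols; apply: le_trans (enorm_sum _ _) _.
rewrite mulr_suml; apply: ler_sum => j _; rewrite enormZ mulrC.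
by rewrite ler_wpM2l ?enorm_ge0 ?cmod_le_enorm.
Qed.

Let opset A := [set enorm (A *m x) | x in [set x : 'cV[R[i]]_d | enorm x <= 1]].

Let opset_has_sup A : has_sup (opset A).
Proof.
split; first by exists (enorm (A *m 0)), 0 => //=; rewrite enorm0 ler01.
exists (\sum_j enorm (col j A)) => _ [x /= x1 <-].
apply: le_trans (enorm_mul_cols _ _) _.
by rewrite ler_piMr// sumr_ge0// => j _; exact: enorm_ge0.
Qed.

Lemma opnorm_ge A x : enorm x <= 1 -> enorm (A *m x) <= opnorm A.
Proof. by move=> x1; apply: sup_upper_bound (opset_has_sup A) _ _; exists x. Qed.

Lemma opnorm_gt (c : R) A :
  c < opnorm A <-> exists2 x, enorm x <= 1 & c < enorm (A *m x).
Proof.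
split=> [cA|[x x1 cA]]; last exact: lt_le_trans cA (opnorm_ge A x x1).
have e0 : 0 < opnorm A - c by rewrite subr_gt0.
have [_ [x x1 <-] lx] := sup_adherent e0 (opset_has_sup A).
by exists x => //; move: lx; rewrite opprB addrCA subrr addr0.
Qed.

Lemma opnorm_ge0 A : 0 <= opnorm A.
Proof. by apply: le_trans (opnorm_ge A 0 _); rewrite ?enorm_ge0 ?enorm0. Qed.

Lemma enorm_mul A x : enorm (A *m x) <= opnorm A * enorm x.
Proof.
have [->|x0] := eqVneq x 0; first by rewrite mulmx0 enorm0 mulr0.
have nx : 0 < enorm x by rewrite enorm_gt0.
have := opnorm_ge A (((enorm x)^-1)%:C *: x).
rewrite enormZ cmodC ger0_norm ?invr_ge0 ?enorm_ge0// mulVf ?gt_eqF// lexx.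
rewrite -scalemxAr enormZ cmodC ger0_norm ?invr_ge0 ?enorm_ge0// => /(_ isT).
by rewrite ler_pdivrMl// mulrC.
Qed.

Lemma opnorm_le_cols A : opnorm A <= \sum_j enorm (col j A).
Proof.
apply: ge_sup; first by have [] := opset_has_sup A.
move=> _ [x /= x1 <-]; apply: le_trans (enorm_mul_cols _ _) _.
by rewrite ler_piMr// sumr_ge0// => j _; exact: enorm_ge0.
Qed.

Lemma opnorm_eq0 A : opnorm A = 0 -> A = 0.
Proof.
move=> A0; apply/matrixP => i j; rewrite mxE.
have := enorm_mul A (delta_mx j 0); rewrite A0 mul0r -colE => h.
have /eqP : enorm (col j A) = 0 by apply/eqP; rewrite eq_le h enorm_ge0.
by rewrite enorm_eq0 => /eqP/matrixP/(_ i 0); rewrite !mxE.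
Qed.

Lemma wnorm_cols X : wnorm X ^+ 2 = 2^-1 * \sum_j enorm (col j X) ^+ 2.
Proof.
rewrite sqr_wnorm exchange_big /=; congr (_ * _); apply: eq_bigr => j _.
by rewrite sqr_enorm; apply: eq_bigr => i _; rewrite !mxE.
Qed.

Lemma wnorm_tr X : wnorm X^T = wnorm X.
Proof.
apply/eqP; rewrite -(@eqrXn2 _ 2)// ?wnorm_ge0// !sqr_wnorm exchange_big /=.
apply/eqP; congr (_ * _); apply: eq_bigr => i _; apply: eq_bigr => j _.
by rewrite !mxE.
Qed.

(** Up to the factor 1/2, [wnorm] squared is the sum of the squared norms of the columns, and A acts
    on each column. After a transposition the same bound holds for a factor A^T on the right, whence
    |wedge^2 A| <= |A|^2. *)
Lemma wnorm_mul A X : wnorm (A *m X) <= opnorm A * wnorm X.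
Proof.
rewrite -(@ler_pXn2r _ 2)// ?nnegrE ?mulr_ge0 ?wnorm_ge0 ?opnorm_ge0//.
rewrite exprMn !wnorm_cols mulrCA ler_pM2l ?invr_gt0 ?ltr0n//.
rewrite mulr_sumr; apply: ler_sum => j _; rewrite -exprMn.
rewrite ler_pXn2r// ?nnegrE ?mulr_ge0 ?enorm_ge0 ?opnorm_ge0//.
have -> : col j (A *m X) = A *m col j X by rewrite !colE mulmxA.
exact: enorm_mul.
Qed.

Lemma wnorm_wedge2 A X : wnorm (wedge2 A X) <= opnorm A ^+ 2 * wnorm X.
Proof.
rewrite /wedge2 -wnorm_tr trmx_mul trmxK; apply: le_trans (wnorm_mul _ _) _.
by rewrite expr2 -mulrA ler_wpM2l ?opnorm_ge0// wnorm_tr wnorm_mul.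
Qed.

Lemma wnorm0 : wnorm (0 : 'M[R[i]]_d) = 0.
Proof.
apply/eqP; rewrite -(@eqrXn2 _ 2)// ?wnorm_ge0// sqr_wnorm big1 ?mulr0 ?expr0n//.
by move=> i _; rewrite big1// => j _; rewrite mxE ComplexField.Normc.normc0 expr0n.
Qed.

Lemma wnorm_eq0 X : wnorm X = 0 -> X = 0.
Proof.
move=> X0; apply/matrixP => i j; rewrite mxE.
have /eqP := wnorm_cols X; rewrite X0 expr0n /= eq_sym mulf_eq0 invr_eq0.
rewrite pnatr_eq0 /= psumr_eq0; last by move=> ? _; exact: sqr_ge0.
move=> /allP/(_ j); rewrite mem_index_enum => /(_ isT) /=.
by rewrite sqrf_eq0 enorm_eq0 => /eqP/matrixP/(_ i 0); rewrite !mxE.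
Qed.

Lemma wnormZ z X : wnorm (z *: X) = cmod z * wnorm X.
Proof.
apply/eqP; rewrite -(@eqrXn2 _ 2)// ?mulr_ge0 ?cmod_ge0 ?wnorm_ge0//.
rewrite exprMn !wnorm_cols mulrCA [in X in _ == X]mulr_sumr.
apply/eqP; congr (_ * _); apply: eq_bigr => j _.
by rewrite -exprMn -enormZ; congr (enorm _ ^+ 2); apply/matrixP => i k;
  rewrite !mxE.
Qed.

Let wset A := [set wnorm (wedge2 A X) |
  X in [set X : 'M[R[i]]_d | wedge2_space X /\ wnorm X <= 1]].

Let wset_has_sup A : has_sup (wset A).
Proof.
have sk0 : wedge2_space (0 : 'M[R[i]]_d).
  by rewrite /wedge2_space /= trmx0 oppr0.
split; first by exists (wnorm (wedge2 A 0)), 0 => //=; rewrite wnorm0 ler01.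
exists (opnorm A ^+ 2) => _ [X /= [_ X1] <-].
by apply: le_trans (wnorm_wedge2 _ _) _; rewrite ler_piMr ?sqr_ge0.
Qed.

Lemma wedge2_norm_gt (c : R) A : c < wedge2_norm A <->
  exists2 X, wedge2_space X /\ wnorm X <= 1 & c < wnorm (wedge2 A X).
Proof.
split=> [cA|[X X1 cA]]; last first.
  by apply: lt_le_trans cA _; apply: sup_upper_bound (wset_has_sup A) _ _; exists X.
have e0 : 0 < wedge2_norm A - c by rewrite subr_gt0.
have [_ [x x1 <-] lx] := sup_adherent e0 (wset_has_sup A).
by exists x => //; move: lx; rewrite opprB addrCA subrr addr0.
Qed.

Lemma wedge2_norm_le A : wedge2_norm A <= opnorm A ^+ 2.
Proof.
apply: ge_sup; first by have [] := wset_has_sup A.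
move=> _ [X /= [_ X1] <-].
by apply: le_trans (wnorm_wedge2 _ _) _; rewrite ler_piMr ?sqr_ge0.
Qed.

Lemma wedge2_norm_ge A X :
  wedge2_space X -> wnorm (wedge2 A X) <= wedge2_norm A * wnorm X.
Proof.
move=> skX; have [X0|X0] := eqVneq (wnorm X) 0.
  by rewrite X0 (wnorm_eq0 _ X0) /wedge2 mulmx0 mul0mx wnorm0 mulr0.
have nX : 0 < wnorm X by rewrite lt_neqAle wnorm_ge0 eq_sym X0.
rewrite mulrC -ler_pdivrMl//.
have cE : cmod ((wnorm X)^-1)%:C = (wnorm X)^-1.
  by rewrite cmodC ger0_norm ?invr_ge0 ?wnorm_ge0.
rewrite -[X in X * _]cE -wnormZ.
apply: sup_upper_bound (wset_has_sup A) _ _.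
exists (((wnorm X)^-1)%:C *: X) => /=.
  split; last by rewrite wnormZ cE mulVf.
  by rewrite /wedge2_space /= linearZ /= skX scalerN.
by rewrite /wedge2 -scalemxAr -scalemxAl.
Qed.

Lemma wedge2_norm_ge0 A : 0 <= wedge2_norm A.
Proof.
have sk0 : wedge2_space (0 : 'M[R[i]]_d).
  by rewrite /wedge2_space /= trmx0 oppr0.
apply: le_trans (wnorm_ge0 (wedge2 A 0)) _.
by apply: sup_upper_bound (wset_has_sup A) _ _; exists 0 => //=; rewrite wnorm0.
Qed.

End hermitian.

(** * Homogeneous functions and the projective space *)

Section powR_estimates.
Context {R : realType}.
Implicit Types (a s p q N c : R) (m : nat).

(** A number of [0,1] does not decrease when raised to a power a <= 1; this is applied to c and to 1
    - c. *)
Lemma powR_subadd1 a c : 0 < a <= 1 -> 0 <= c <= 1 -> 1 <= c `^ a + (1 - c) `^ a.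
Proof.
move=> /andP[a0 a1] /andP[c0 c1].
have le_pow b : 0 <= b <= 1 -> b <= b `^ a.
  move=> /andP[]; rewrite le_eqVlt => /predU1P[<- _|b0 b1]; first exact: powR_ge0.
  by apply: ger1_powR; rewrite ?b0.
rewrite -[leLHS](subrKC c); apply: lerD; apply: le_pow; first by rewrite c0.
by rewrite subr_ge0 c1 lerBlDr lerDl.
Qed.

Lemma bernoulli_le m (c : R) : 0 <= c <= 1 -> 1 - c ^+ m <= m%:R * (1 - c).
Proof.
move=> /andP[c0 c1]; elim: m => [|m ih]; first by rewrite expr0 subrr mul0r.
have -> : 1 - c ^+ m.+1 = 1 - c ^+ m + c ^+ m * (1 - c) by rewrite exprSr; ring.
rewrite -natr1 mulrDl mul1r lerD// ler_piMl ?subr_ge0//.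
exact: exprn_ile1.
Qed.

Lemma powR_le1 s c : 0 <= s -> 0 <= c <= 1 -> c `^ s <= 1.
Proof.
move=> s0 /andP[c0 c1].
by have := ge0_ler_powR s0 c0 ler01 c1; rewrite powR1.
Qed.

(* With c = q / p, this is 1 - c^s <= 1 - (c^a)^m <= m (1 - c^a) <= m (1 - c)^a. *)
Lemma powR_sub_le a s p q N m : 0 < a <= 1 -> a <= s -> s <= m%:R * a ->
  0 <= q <= p -> p <= N ->
  p `^ s - q `^ s <= m%:R * N `^ (s - a) * (p - q) `^ a.
Proof.
move=> /andP[a0 a1] as_ sm /andP[q0 qp] pN.
have s0 : 0 < s by exact: lt_le_trans as_.
have p0 : 0 <= p by exact: le_trans qp.
move: p0; rewrite le_eqVlt => /predU1P[p0|p0].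
  have -> : q = 0 by apply/eqP; rewrite eq_le q0 p0 qp.
  by rewrite -p0 subrr !mulr_ge0 ?powR_ge0.
pose c := q / p; have c0 : 0 <= c by rewrite divr_ge0// ltW.
have c1 : c <= 1 by rewrite ler_pdivrMr// mul1r.
have qE : q = p * c by rewrite mulrC divfK ?gt_eqF.
clearbody c; have -> : p - q = p * (1 - c) by rewrite qE mulrBr mulr1.
rewrite qE !powRM ?subr_ge0 ?(ltW p0)//.
have -> : p `^ s - p `^ s * c `^ s = p `^ (s - a) * (p `^ a * (1 - c `^ s)).
  rewrite mulrA -powRD ?subrK; last by rewrite (gt_eqF s0).
  by rewrite mulrBr mulr1.
rewrite -mulrA [leRHS]mulrCA; apply: ler_pM;
  rewrite ?powR_ge0 ?mulr_ge0 ?powR_ge0//.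
- by rewrite subr_ge0 powR_le1 ?c0// ltW.
- apply: ge0_ler_powR; rewrite ?nnegrE ?subr_ge0 ?(ltW p0)//.
  exact: le_trans (ltW p0) pN.
rewrite mulrCA; apply: ler_wpM2l; first exact: powR_ge0.
apply: (@le_trans _ _ (1 - (c `^ a) ^+ m)).
  rewrite lerD2l lerN2 -powR_mulrn ?powR_ge0// -powRrM mulrC.
  move: c0; rewrite le_eqVlt => /predU1P[<-|c0].
    rewrite !powR0 ?gt_eqF//; exact: lt_le_trans sm.
  by apply: ger_powR; rewrite ?c0.
have ca1 : c `^ a <= 1 by rewrite powR_le1 ?c0// ltW.
apply: le_trans (bernoulli_le _ _ _) _; first by rewrite powR_ge0.
rewrite ler_wpM2l// lerBlDl powR_subadd1 ?a0 ?c0//.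
Qed.

(** The sum is at most d times its largest term, which treats s below and above 1 alike. *)
Lemma powR_sum_le d s (F : 'I_d -> R) : 0 < s -> (forall j, 0 <= F j) ->
  (\sum_j F j) `^ s <= d%:R `^ s * \sum_j F j `^ s.
Proof.
case: d F => [|d] F s0 F0.
  by rewrite !big_ord0 mulr0 powR0 ?gt_eqF.
have [j Fj] : exists j, forall i, F i <= F j.
  by exists [arg max_(i > ord0) F i]%O => i; case: arg_maxP => // j _; exact.
apply: (@le_trans _ _ ((d.+1%:R * F j) `^ s)).
  apply: ge0_ler_powR; rewrite ?nnegrE ?mulr_ge0 ?sumr_ge0 ?(ltW s0)//.
  rewrite mulr_natl -[in leRHS](card_ord d.+1) -sumr_const.
  by apply: ler_sum => i _; exact: Fj.
rewrite powRM// ler_wpM2l ?powR_ge0// (bigD1 j)//= lerDl sumr_ge0// => i _.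
exact: powR_ge0.
Qed.

End powR_estimates.

(** * Lines, their distance, and homogeneous extensions *)

Section projective_space.
Context {R : realType} {d : nat}.
Implicit Types (L : pspace R d) (X Y U V : 'cV[R[i]]_d) (z : R[i]).

Lemma vpick_pspace_neq0 L : vpick (val L) != 0.
Proof. by case: L => L /= /eqP dL; rewrite vpick0 -dimv_eq0 dL. Qed.

Lemma enorm_urep L : enorm (urep L) = 1.
Proof.
have n0 : 0 < enorm (vpick (val L)) by rewrite enorm_gt0 vpick_pspace_neq0.
by rewrite enormZ cmodC ger0_norm ?invr_ge0 ?enorm_ge0// mulVf ?gt_eqF.
Qed.

Lemma urep_neq0 L : urep L != 0.
Proof. by rewrite -enorm_gt0 enorm_urep. Qed.

Lemma vline_urep L : <[urep L]>%VS = val L.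
Proof.
apply/eqP; rewrite eqEdim -memvE dim_vline urep_neq0 memvZ ?memv_pick//=.
by case: L => L /= /eqP ->.
Qed.

(** The same [insub] as in [pact]: [pact v L] unfolds to [line (v *m urep L)]. *)
Definition line X : option (pspace R d) := insub <[X]>%VS.

Lemma line0 : line 0 = None.
Proof. by rewrite /line insubF// dim_vline eqxx. Qed.

Lemma line_urep L : line (urep L) = Some L.
Proof. by rewrite /line vline_urep valK. Qed.

Lemma lineP X : X != 0 ->
  exists L, line X = Some L /\ exists z, X = z *: urep L.
Proof.
move=> X0; rewrite /line; case: insubP => [L _ LE|]; last by rewrite dim_vline X0.
by exists L; split=> //; apply/vlineP; rewrite vline_urep LE memv_line.
Qed.

Lemma lineZ z X : z != 0 -> line (z *: X) = line X.
Proof.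
move=> z0; congr insub; apply/eqP; rewrite eqEsubv -!memvE memvZ ?memv_line//=.
by rewrite -[X in X \in _](scalerK z0) memvZ ?memv_line.
Qed.

(** Lagrange's identity for unit vectors. In this form the distance is a wedge norm, on which
    [wedge2] acts. *)
Lemma pdistE L1 L2 : pdist L1 L2 = wnorm (wedge (urep L1) (urep L2)).
Proof.
rewrite /pdist -[RHS]ger0_norm ?wnorm_ge0// -sqrtr_sqr sqr_wnorm_wedge.
by rewrite !enorm_urep expr1n mul1r.
Qed.

Lemma pdist_le1 L1 L2 : pdist L1 L2 <= 1.
Proof. by rewrite pdistE (le_trans (wnorm_wedge_le _ _))// !enorm_urep mul1r. Qed.

Lemma pdist_ge0 L1 L2 : 0 <= pdist L1 L2.
Proof. by rewrite pdistE wnorm_ge0. Qed.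

Lemma wedge_entry X Y i j :
  wedge X Y i j = X i 0 * Y j 0 - Y i 0 * X j 0.
Proof. by rewrite !mxE !big_ord1 !mxE. Qed.

(** A vanishing wedge makes the representatives proportional, with the ratio read off at a nonzero
    coordinate of the second one. *)
Lemma pdist_gt0 L1 L2 : L1 != L2 -> 0 < pdist L1 L2.
Proof.
apply: contraNT; rewrite -leNgt => d0.
have /wnorm_eq0/matrixP w0 : wnorm (wedge (urep L1) (urep L2)) = 0.
  by apply/eqP; rewrite eq_le wnorm_ge0 -pdistE d0.
have /cV0Pn[j yj] := urep_neq0 L2.
have E : urep L1 = (urep L1 j 0 / urep L2 j 0) *: urep L2.
  move: (urep L1) (urep L2) yj w0 => x y yj w0.
  apply/matrixP => i k; rewrite ord1 mxE; apply: (mulIf yj).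
  have := w0 i j; rewrite wedge_entry mxE => /eqP; rewrite subr_eq0 => /eqP ->.
  by rewrite mulrAC divfK// mulrC.
apply/eqP/val_inj; rewrite -!vline_urep E; apply/eqP; rewrite eqEdim -memvE.
rewrite memvZ ?memv_line//= -E.
by apply: (@leq_trans 1); rewrite dim_vline ?urep_neq0 ?leq_b1.
Qed.

Lemma wedgeC X Y : wedge X Y = - wedge Y X.
Proof. by rewrite /wedge opprB. Qed.

Lemma wnormN (X : 'M[R[i]]_d) : wnorm (- X) = wnorm X.
Proof. by rewrite -scaleN1r wnormZ normcN ComplexField.Normc.normc1 mul1r. Qed.

Lemma wedgeZ z1 z2 X Y : wedge (z1 *: X) (z2 *: Y) = (z1 * z2) *: wedge X Y.
Proof.
by apply/matrixP => i j; rewrite [RHS]mxE !wedge_entry !mxE; ring.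
Qed.

(* Aligning the phases of the representatives makes <x, z y> nonnegative. *)
Lemma phase_align L1 L2 : exists2 z, cmod z = 1 &
  enorm (urep L1 - z *: urep L2) <= 2 * pdist L1 L2.
Proof.
set h := hdot (urep L1) (urep L2).
have [z z1 zh] : exists2 z, cmod z = 1 & z^* * h = (cmod h)%:C.
  have [->|h0] := eqVneq h 0.
    by exists 1; rewrite ?ComplexField.Normc.normc1// mulr0
      ComplexField.Normc.normc0.
  have ch : cmod h != 0 by apply: contra_neq h0 => /ComplexField.Normc.eq0_normc.
  exists (h * (cmod h)^-1%:C).
    rewrite ComplexField.Normc.normcM cmodC.
    by rewrite ger0_norm ?invr_ge0 ?cmod_ge0// divff.
  have -> (t : R) (w : R[i]) : Num.conj (w * t%:C) = Num.conj w * t%:C.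
    by case: w => u v; apply/eqP; rewrite eq_complex /=; apply/andP; split;
      apply/eqP; ring.
  by rewrite mulrAC (mulrC h^*) -sqr_cmod -rmorphM /= expr2 mulfK.
exists z => //.
have h1 : cmod h <= 1 by rewrite (le_trans (cauchy_schwarz _ _))// !enorm_urep
  mul1r.
(* The squares are 2 - 2|h| and 4 (1 - |h|^2) = 4 (1 - |h|) (1 + |h|), and 0 <= |h| <= 1. *)
rewrite -(@ler_pXn2r _ 2)// ?nnegrE ?enorm_ge0 ?mulr_ge0 ?pdist_ge0//.
rewrite sqr_enormD enormN (enormZ z) z1 !enorm_urep mul1r !expr1n.
rewrite -scaleNr hdotZr rmorphN /= mulNr -/h zh /=.
rewrite exprMn pdistE sqr_wnorm_wedge !enorm_urep expr1n mul1r -/h.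
have := cmod_ge0 h; nra.
Qed.

Context (s : R).

(* The s-homogeneous extension of f to C^d; junk value 0 at 0. *)
Definition hom (f : pspace R d -> R) X : R :=
  if line X is Some L then f L * enorm X `^ s else 0.

Lemma hom0 f : hom f 0 = 0.
Proof. by rewrite /hom line0. Qed.

Lemma hom_urep f L : hom f (urep L) = f L.
Proof. by rewrite /hom line_urep enorm_urep powR1 mulr1. Qed.

Lemma homZ f z X : 0 < s -> hom f (z *: X) = cmod z `^ s * hom f X.
Proof.
move=> s0; have [->|z0] := eqVneq z 0.
  by rewrite scale0r hom0 ComplexField.Normc.normc0 powR0 ?gt_eqF// mul0r.
rewrite /hom lineZ//; case: line => [L|]; last by rewrite mulr0.
by rewrite enormZ powRM ?cmod_ge0 ?enorm_ge0// mulrCA.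
Qed.

Lemma hom_le f g X : (forall L, f L <= g L) -> hom f X <= hom g X.
Proof. by move=> fg; rewrite /hom; case: line => // L;
  rewrite ler_wpM2r ?powR_ge0. Qed.

Lemma hom_scale f c X : hom (fun L => c * f L) X = c * hom f X.
Proof. by rewrite /hom; case: line => [L|]; rewrite ?mulrA ?mulr0. Qed.

Lemma norm_hom f X : `|hom f X| = hom (fun L => `|f L|) X.
Proof.
rewrite /hom; case: line => [L|]; last by rewrite normr0.
by rewrite normrM (ger0_norm (powR_ge0 _ _)).
Qed.

Lemma hom_cst c X : 0 < s -> hom (fun=> c) X = c * enorm X `^ s.
Proof.
move=> s0; have [->|/lineP[L [lX _]]] := eqVneq X 0.
  by rewrite hom0 enorm0 powR0 ?gt_eqF ?mulr0.
by rewrite /hom lX.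
Qed.

Lemma hom_bound f K X : 0 < s -> (forall L, `|f L| <= K) ->
  `|hom f X| <= K * enorm X `^ s.
Proof. by move=> s0 fK; rewrite norm_hom -hom_cst// hom_le. Qed.

(** Real constants replace the extended-valued norms, so that they can be computed with. *)
Definition holderc (a K H : R) (f : pspace R d -> R) : Prop :=
  (forall L, `|f L| <= K) /\
  (forall L1 L2, `|f L1 - f L2| <= H * pdist L1 L2 `^ a).

(** N is a common bound for the two norms, |w| in the main application, and m is the integer
    exponent that lets [powR_sub_le] compare s-th powers through Bernoulli's inequality. When one
    vector is 0, the K term alone suffices. *)
Lemma hom_estimate a K H f m N U V : 0 < a <= 1 -> 2 * a < s ->
  s <= m%:R * a -> 0 <= K -> 0 <= H -> holderc a K H f ->
  enorm U <= N -> enorm V <= N ->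
  `|hom f U - hom f V| <= H * wnorm (wedge U V) `^ a * N `^ (s - 2 * a) +
    K * (m%:R * N `^ (s - a) * `|enorm U - enorm V| `^ a).
Proof.
move=> /andP[a0 a1] as2 sm K0 H0 [fK fH].
have as_ : a <= s by lra.
have s0 : 0 < s by lra.
wlog UV : U V / enorm U <= enorm V => [th UN VN|UN VN].
  have [|/ltW] := leP (enorm U) (enorm V); first by move/th; exact.
  by move=> /th/(_ VN UN); rewrite wedgeC wnormN distrC (distrC (enorm V)).
rewrite (distrC (enorm U)) (@ger0_norm _ (enorm V - _)) ?subr_ge0//.
have N0 : 0 <= N := le_trans (enorm_ge0 _) UN.
have key : `|enorm V `^ s - enorm U `^ s| <=
           m%:R * N `^ (s - a) * (enorm V - enorm U) `^ a.
  rewrite ger0_norm; last first.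
    by rewrite subr_ge0 ge0_ler_powR// ?nnegrE ?enorm_ge0// ltW.
  by apply: powR_sub_le; rewrite ?a0 ?enorm_ge0.
have [U0|/lineP[LU [lU [zU UE]]]] := eqVneq U 0.
  rewrite {1}U0 hom0 sub0r normrN ler_wpDl ?mulr_ge0 ?powR_ge0//.
  apply: le_trans (hom_bound _ _ _ _ fK) _ => //; rewrite ler_wpM2l//.
  apply: le_trans key; rewrite U0 enorm0 powR0 ?gt_eqF// subr0.
  exact: ler_norm.
have [V0|/lineP[LV [lV [zV VE]]]] := eqVneq V 0.
  move: UV; rewrite V0 enorm0 => eU.
  have /eqP : enorm U = 0 by apply/eqP; rewrite eq_le eU enorm_ge0.
  rewrite enorm_eq0 => /eqP U0.
  by rewrite {1}U0 hom0 subrr normr0 addr_ge0 ?mulr_ge0 ?powR_ge0.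
rewrite /hom lU lV.
have -> : f LU * enorm U `^ s - f LV * enorm V `^ s =
   (f LU - f LV) * enorm U `^ s - f LV * (enorm V `^ s - enorm U `^ s) by ring.
apply: le_trans (ler_normB _ _) _; rewrite !normrM; apply: lerD; last first.
  by apply: ler_pM => //; exact: normr_ge0.
rewrite (ger0_norm (powR_ge0 _ _)).
apply: (@le_trans _ _ (H * pdist LU LV `^ a * enorm U `^ s)).
  by rewrite ler_wpM2r ?powR_ge0.
rewrite -!mulrA ler_wpM2l//.
have -> : wnorm (wedge U V) = enorm U * enorm V * pdist LU LV.
  rewrite UE VE wedgeZ wnormZ ComplexField.Normc.normcM -pdistE.
  have eL z L : enorm (z *: urep L) = cmod z by rewrite enormZ enorm_urep mulr1.
  by congr (_ * _ * _); rewrite eL.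
(* Of the factors |U|^a |U|^a |U|^(s-2a), one |U|^a is raised to |V|^a to form |U /\ V|^a, and the
   last one is raised to N^(s-2a). *)
have dE : s = a + (a + (s - 2 * a)) by ring.
rewrite {1}dE (@powRD _ (enorm U) a (a + (s - 2 * a))); last first.
  by rewrite gt_eqF//; lra.
rewrite (@powRD _ (enorm U) a (s - 2 * a)); last by rewrite gt_eqF//; lra.
have le_pow (r : R) : 0 <= r -> enorm U `^ r <= enorm V `^ r /\ enorm U `^ r <=
  N `^ r.
  by move=> r0; split; apply: ge0_ler_powR; rewrite ?nnegrE ?enorm_ge0.
have [_ UN2] := le_pow (s - 2 * a) ltac:(lra).
have [UVa _] := le_pow a (ltW a0).
rewrite !powRM ?mulr_ge0 ?enorm_ge0 ?pdist_ge0//.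
rewrite mulrC -!mulrA ler_wpM2l ?powR_ge0// [leRHS]mulrCA mulrCA [leRHS]mulrCA.
rewrite [leLHS]mulrA [leLHS]mulrC; apply: ler_wpM2l; first exact: powR_ge0.
by apply: ler_pM => //; exact: powR_ge0.
Qed.

End projective_space.

(** * Borel measurability on matrices *)

Section matrix_measurability.
Context {R : realType} {d : nat}.
Local Notation M := 'M[R[i]^o]_d.
Implicit Types (w v : 'M[R[i]]_d) (X Y : 'cV[R[i]]_d).

Lemma open_matrixP (U : set M) : open U <->
  forall w, U w -> exists2 r : R, 0 < r &
    forall v, (forall i j, cmod (v i j - w i j) < r) -> U v.
Proof.
split=> [oU w Uw|h].
  have /nbhs_ballP[e /= e0 eU] : nbhs (w : M) U by exact: open_nbhs_nbhs.
  (* Radii of balls are elements of R[i]; being positive, e is real. *)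
  have eE : e = (complex.Re e)%:C by rewrite RRe_real// gtr0_real.
  exists (complex.Re e); first by rewrite -ltcR -eE.
  move=> v vw; apply: eU; split=> // i j; rewrite eE.
  by rewrite /ball /= distrC cmod_norm ltcR.
rewrite openE => w /h[r r0 rU]; apply/nbhs_ballP; exists r%:C;
  first by rewrite /= ltcR.
move=> v [_ /= wv]; apply: rU => i j; have := wv i j.
by rewrite /ball /= distrC cmod_norm ltcR.
Qed.

(** Suited to [opnorm] and [wedge2_norm], which are suprema of continuous functions: a strict lower
    bound is witnessed by a single vector or tensor, and persists for nearby matrices. *)
Lemma measurable_lsc (g : Mborel R d -> R) :
  (forall c, open ([set w | c < g w] : set M)) -> measurable_fun setT g.
Proof.
move=> og; apply: (measurability _ (RGenOInfty.measurableE R)).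
move=> _ [_ [c ->] <-]; rewrite setTI; apply: sub_sigma_algebra.
by have := og c; congr open; apply/seteqP; split => w /=; rewrite in_itv/= andbT.
Qed.

Lemma measurable_cont (g : Mborel R d -> R) :
  (forall w e, 0 < e -> exists2 r : R, 0 < r &
    forall v, (forall i j, cmod (v i j - w i j) < r) -> `|g v - g w| < e) ->
  measurable_fun setT g.
Proof.
move=> cg; apply: measurable_lsc => c; apply/open_matrixP => w /= cw.
have [r r0 rU] := cg w (g w - c) ltac:(by rewrite subr_gt0).
exists r => // v /rU; rewrite ltr_distl => /andP[+ _].
by rewrite opprB addrCA subrr addr0.
Qed.

Lemma sumr_ord_le (F : 'I_d -> R) (c : R) :
  (forall i, F i <= c) -> \sum_i F i <= d%:R * c.
Proof.
move=> Fc; have -> : d%:R * c = \sum_(i < d) c by rewrite sumr_const card_ord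
  mulr_natl.
by apply: ler_sum => i _.
Qed.

Lemma sum_enorm_cols_le w (c : R) : (forall i j, cmod (w i j) <= c) ->
  \sum_j enorm (col j w) <= (d * d)%:R * c.
Proof.
move=> wc; rewrite natrM -mulrA; apply: sumr_ord_le => j.
apply: le_trans (enorm_le_sum _) _; apply: sumr_ord_le => i.
by rewrite mxE.
Qed.

Lemma enorm_mulmx_near X (e : R) : 0 < e -> exists2 r : R, 0 < r &
  forall w v, (forall i j, cmod (v i j - w i j) < r) ->
  enorm (v *m X - w *m X) < e.
Proof.
move=> e0; pose c : R := (d * d)%:R * enorm X + 1.
have c0 : 0 < c by rewrite ltr_wpDl// mulr_ge0 ?enorm_ge0.
exists (e / c); first by rewrite divr_gt0.
move=> w v vw; rewrite -mulmxBl; apply: le_lt_trans (enorm_mul_cols _ _) _.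
have : \sum_j enorm (col j (v - w)) <= (d * d)%:R * (e / c).
  by apply: sum_enorm_cols_le => i j; rewrite !mxE ltW.
move=> /(ler_wpM2r (enorm_ge0 X))/le_lt_trans; apply.
rewrite mulrAC mulrA ltr_pdivrMr// mulrC ltr_pM2l//.
by rewrite ltrDl.
Qed.

Lemma measurable_mulmx_cont X (F : 'cV[R[i]]_d -> R) :
  (forall U e, 0 < e -> exists2 r : R, 0 < r &
    forall V, enorm (V - U) < r -> `|F V - F U| < e) ->
  measurable_fun [set: Mborel R d] (fun w => F (w *m X)).
Proof.
move=> cF; apply: measurable_cont => w e e0.
have [r r0 rF] := cF (w *m X) e e0.
have [t t0 tF] := enorm_mulmx_near X r r0.
by exists t => // v /tF/rF.
Qed.

Lemma measurable_enorm_mul X :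
  measurable_fun [set: Mborel R d] (fun w => enorm (w *m X)).
Proof.
apply: (measurable_mulmx_cont X (@enorm R d)) => U e e0.
exists e => // V VU; exact: le_lt_trans (enormB_le _ _) VU.
Qed.

Lemma measurable_opnorm : measurable_fun [set: Mborel R d] (@opnorm R d).
Proof.
apply: measurable_lsc => c.
apply/open_matrixP => w /= /opnorm_gt[X X1 cX].
have [r r0 rF] := enorm_mulmx_near X (enorm (w *m X) - c) ltac:(by rewrite
  subr_gt0).
exists r => // v /rF vX; apply/opnorm_gt; exists X => //.
have := le_lt_trans (enormB_le _ _) vX.
by rewrite ltr_distl => /andP[+ _]; rewrite opprB addrCA subrr addr0.
Qed.

(** Flattening the matrix transfers the triangle inequality from [enorm] to [wnorm]. *)
Lemma wnorm_mxvec (X : 'M[R[i]]_d) : wnorm X = Num.sqrt 2^-1 * enorm (mxvec X)^T.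
Proof.
apply/eqP; rewrite -(@eqrXn2 _ 2)// ?wnorm_ge0// ?mulr_ge0 ?sqrtr_ge0 ?enorm_ge0//.
rewrite exprMn sqr_wnorm sqr_enorm sqr_sqrtr ?invr_ge0// pair_bigA /=.
apply/eqP; congr (_ * _).
rewrite [RHS](reindex _ (curry_mxvec_bij _ _)) /=.
by apply: eq_bigr => -[i j] _; rewrite /= mxE mxvecE.
Qed.

Lemma wnormD (X Y : 'M[R[i]]_d) : wnorm (X + Y) <= wnorm X + wnorm Y.
Proof.
by rewrite !wnorm_mxvec !linearD /= -mulrDr ler_wpM2l ?sqrtr_ge0// enormD.
Qed.

Lemma wnorm_wedge2_near (X : 'M[R[i]]_d) w (e : R) : 0 < e ->
  exists2 r : R, 0 < r & forall v, (forall i j, cmod (v i j - w i j) < r) ->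
  wnorm (wedge2 w X) < wnorm (wedge2 v X) + e.
Proof.
(* With b = v - w, the tensor w X w^T differs from v X v^T by w X b^T + b X v^T, of norm at most |b|
   (|w| + |v|) |X|. The condition |b| <= 1 replaces |v| by |w| + 1, and the final 1 makes c
   positive. *)
move=> e0; pose c : R := (opnorm w + (opnorm w + 1)) * wnorm X + 1.
have c0 : 0 < c.
  by rewrite ltr_wpDl// mulr_ge0 ?addr_ge0 ?wnorm_ge0 ?opnorm_ge0.
pose t : R := Num.min 1 (e / c).
have t0 : 0 < t by rewrite lt_min ltr01 divr_gt0.
exists (t / ((d * d)%:R + 1)); first by rewrite divr_gt0// ltr_wpDl.
move=> v vw; pose b := v - w.
have bt : opnorm b < t.
  apply: le_lt_trans (opnorm_le_cols _) _.
  apply: (@le_lt_trans _ _ ((d * d)%:R * (t / ((d * d)%:R + 1)))).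
    by apply: sum_enorm_cols_le => i j; rewrite !mxE ltW.
  by rewrite mulrA ltr_pdivrMr ?ltr_wpDl// mulrC ltr_pM2l// ltrDl.
have t1 : opnorm b <= 1 by rewrite ltW// (lt_le_trans bt)// ge_min lexx.
have tc : opnorm b * c < e by rewrite -ltr_pdivlMr// (lt_le_trans bt)// ge_min
  lexx orbT.
have vE : v = w + b by rewrite addrC subrK.
have opv : opnorm v <= opnorm w + 1.
  apply: ge_sup => [|_ [x /= x1 <-]]; first by exists (enorm (v *m 0)), 0;
    rewrite //= enorm0.
  rewrite vE mulmxDl; apply: le_trans (enormD _ _) _; apply: lerD.
    exact: opnorm_ge.
  exact: le_trans (opnorm_ge _ _ x1) t1.
have -> : wedge2 w X = wedge2 v X - (w *m X *m b^T + b *m X *m v^T).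
  rewrite /wedge2 /b linearB /= mulmxBl mulmxBr mulmxBl.
  by rewrite [X in _ = _ - X]addrC subrKA opprB addrC subrK.
apply: le_lt_trans (wnormD _ _) _; rewrite ltrD2l wnormN.
apply: le_lt_trans (wnormD _ _) _; apply: le_lt_trans tc.
have tr_le (A Y : 'M[R[i]]_d) : wnorm (Y *m A^T) <= opnorm A * wnorm Y.
  by rewrite -wnorm_tr trmx_mul trmxK (le_trans (wnorm_mul _ _))// wnorm_tr.
apply: (@le_trans _ _ (opnorm b * (opnorm w * wnorm X) +
                       (opnorm w + 1) * (opnorm b * wnorm X))).
  apply: lerD; apply: le_trans (tr_le _ _) _.
    by rewrite ler_wpM2l ?opnorm_ge0 ?wnorm_mul.
  by apply: ler_pM; rewrite ?opnorm_ge0 ?wnorm_ge0 ?wnorm_mul.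
have := opnorm_ge0 b; rewrite /c.
move: (opnorm b) (opnorm w) (wnorm X) => p q n p0.
by rewrite -subr_ge0 [X in 0 <= X](_ : _ = p)//; ring.
Qed.

Lemma measurable_wedge2_norm : measurable_fun [set: Mborel R d] (@wedge2_norm R d).
Proof.
apply: measurable_lsc => c.
apply/open_matrixP => w /= /wedge2_norm_gt[X X1 cX].
have [r r0 rF] := wnorm_wedge2_near X w (wnorm (wedge2 w X) - c) ltac:(by
  rewrite subr_gt0).
exists r; first exact: r0.
move=> v /rF vX; apply/wedge2_norm_gt; exists X; first exact: X1.
by move: vX; rewrite addrCA ltrDl subr_gt0.
Qed.

Lemma measurable_Re_entry i j :
  measurable_fun [set: Mborel R d] (fun w : 'M[R[i]]_d => complex.Re (w i j)).
Proof.
apply: measurable_cont => w e e0; exists e => // v /(_ i j); apply: le_lt_trans.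
by rewrite -raddfB Re_cmod.
Qed.

Lemma measurable_Im_entry i j :
  measurable_fun [set: Mborel R d] (fun w : 'M[R[i]]_d => complex.Im (w i j)).
Proof.
apply: measurable_cont => w e e0; exists e => // v /(_ i j); apply: le_lt_trans.
by rewrite -raddfB Im_cmod.
Qed.

(* The rational boxes form a countable basis of the topology, so the Borel
   sigma-algebra is generated by the real and imaginary parts of the entries. *)
Lemma measurable_entries {dT} {T : measurableType dT} (f : T -> Mborel R d) :
  (forall i j, measurable_fun setT (fun t => complex.Re (f t i j))) ->
  (forall i j, measurable_fun setT (fun t => complex.Im (f t i j))) ->
  measurable_fun setT f.
Proof.
move=> mRe mIm.
apply: (@measurability _ _ T (Mborel R d) setT f (@open M)); first by [].
move=> _ [U oU <-]; rewrite setTI.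
pose box (q : 'M[rat * rat]_d) (n : nat) : set 'M[R[i]]_d := [set w | forall i j,
  `|complex.Re (w i j) - ratr (q i j).1| < n.+1%:R^-1 /\
  `|complex.Im (w i j) - ratr (q i j).2| < n.+1%:R^-1].
have mbox q n : measurable (f @^-1` box q n).
  have -> : f @^-1` box q n = \bigcap_(p in [set: 'I_d * 'I_d])
      ((fun t => complex.Re (f t p.1 p.2)) @^-1`
          (ball (ratr (q p.1 p.2).1 : R) (n.+1%:R^-1)) `&`
       (fun t => complex.Im (f t p.1 p.2)) @^-1`
          (ball (ratr (q p.1 p.2).2 : R) (n.+1%:R^-1))).
    apply/seteqP; split => [t bt [i j] _|t bt i j] /=; rewrite /ball /=.
      by rewrite !(distrC (ratr _)).
    by rewrite !(distrC _ (ratr _)); exact: (bt (i, j)).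
  apply: fin_bigcap_measurable => // p _; apply: measurableI;
    rewrite -[X in measurable X]setTI.
    by apply: mRe => //; exact: measurable_ball.
  by apply: mIm => //; exact: measurable_ball.
have -> : f @^-1` U = \bigcup_(p in [set: 'M[rat * rat]_d * nat])
    (if `[< box p.1 p.2 `<=` U >] then f @^-1` box p.1 p.2 else set0).
  apply/seteqP; split => [t Ut|t [[q n] _]]; last first.
    by case: asboolP => //= bU /bU.
  have /open_matrixP/(_ _ Ut)[r r0 rU] := oU.
  (* The real and the imaginary part are each off by at most two approximation errors, four in
     all. *)
  have [n nr] : exists n, n.+1%:R^-1 < r / 4.
    have r4 : 0 < r / 4 by rewrite divr_gt0.
    have [n _ /(_ n (leqnn n)) /=] := near_infty_natSinv_lt (PosNum r4).
    by exists n.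
  have n0 : 0 < n.+1%:R^-1 :> R by rewrite invr_gt0.
  have approx (x : R) : exists q : rat, `|x - ratr q| < n.+1%:R^-1.
    have /rat_in_itvoo[q] : x - n.+1%:R^-1 < x + n.+1%:R^-1.
      by rewrite ltrD2l (lt_trans _ n0)// oppr_lt0.
    by rewrite in_itv /= => xq; exists q; rewrite distrC ltr_distl.
  have /choice[g gP] := approx.
  exists (\matrix_(i, j) (g (complex.Re (f t i j)), g (complex.Im (f t i j))),
    n) => //=.
  case: asboolP => [_|nbU].
    by move=> i j; rewrite mxE; split; exact: gP.
  exfalso; apply: nbU => v bv; apply: rU => i j; have := bv i j;
    rewrite mxE /= => -[h1 h2].
  apply: le_lt_trans (cmod_ReIm _) _; rewrite !raddfB /=.
  have dist2 (x y z : R) : `|x - z| < n.+1%:R^-1 -> `|y - z| < n.+1%:R^-1 ->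
      `|x - y| < n.+1%:R^-1 + n.+1%:R^-1.
    move=> xz yz; apply: le_lt_trans (ler_distD z _ _) _.
    by rewrite ltrD// distrC.
  have := ltrD (dist2 _ _ _ h1 (gP _)) (dist2 _ _ _ h2 (gP _)).
  move/lt_le_trans; apply; move: nr; rewrite ltr_pdivlMr// => /ltW.
  by apply: le_trans; rewrite -!mulr2n -mulrnA mulr_natr.
apply: countable_bigcupT_measurable; first exact: countableP.
by move=> [q n]; case: asboolP => // _; exact: mbox.
Qed.

(** The pair of f and g is measurable for the product sigma-algebra, so the argument goes through
    the entries, where the product is a polynomial, and not through continuity on pairs. *)
Lemma measurable_mulmx {dT} {T : measurableType dT} (f g : T -> Mborel R d) :
  measurable_fun setT f -> measurable_fun setT g ->
  measurable_fun setT (fun t => (f t : 'M[R[i]]_d) *m (g t : 'M[R[i]]_d) :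
    Mborel R d).
Proof.
move=> mf mg.
have mfRe i j := measurableT_comp (measurable_Re_entry i j) mf.
have mfIm i j := measurableT_comp (measurable_Im_entry i j) mf.
have mgRe i j := measurableT_comp (measurable_Re_entry i j) mg.
have mgIm i j := measurableT_comp (measurable_Im_entry i j) mg.
apply: measurable_entries => i j.
  under eq_fun => t do rewrite mxE raddf_sum /=.
  apply: measurable_sum => k.
  have ReM (x y : R[i]) : complex.Re (x * y) =
      complex.Re x * complex.Re y - complex.Im x * complex.Im y.
    by case: x; case: y.
  under eq_fun => t do rewrite ReM.
  apply: measurable_funB; apply: measurable_funM;
    [exact: mfRe|exact: mgRe|exact: mfIm|exact: mgIm].
under eq_fun => t do rewrite mxE raddf_sum /=.
apply: measurable_sum => k.
have ImM (x y : R[i]) : complex.Im (x * y) =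
    complex.Re x * complex.Im y + complex.Im x * complex.Re y.
  by case: x; case: y.
under eq_fun => t do rewrite ImM.
apply: measurable_funD; apply: measurable_funM;
  [exact: mfRe|exact: mgIm|exact: mfIm|exact: mgRe].
Qed.

End matrix_measurability.

(** * The product measures *)

Section sfinite_complements.
Import HBNNSimple.
Context {dT} {T : measurableType dT} {R : realType}.
Implicit Types (m : {measure set T -> \bar R}).

(** Integrals are built from simple functions, whose level sets are measurable. Hence [mpower], a
    bare set function, may be exchanged under the integral for a measure that agrees with it on
    measurable sets. *)
Lemma eq_integral_setfun (m1 m2 : set T -> \bar R) (f : T -> \bar R) :
  (forall A, measurable A -> m1 A = m2 A) ->
  (\int[m1]_x f x = \int[m2]_x f x)%E.
Proof.
move=> m12.
have E (h : {nnsfun T >-> R}) : sintegral m1 h = sintegral m2 h.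
  by apply: eq_fsbigr => x _; rewrite m12//; exact: measurable_sfunP.
rewrite /integral; congr (ereal_sup _ - ereal_sup _)%E;
  by apply: eq_imagel => h _; exact: E.
Qed.

Lemma sfinite_dirac_infty (x0 : T) :
  sfinite_measure (fun A : set T => if x0 \in A then +oo%E else 0%E : \bar R).
Proof.
exists (fun=> \d_x0) => [_|U mU].
  by apply: lty_fin_num_fun; rewrite /= diracT ltry.
rewrite /mseries /= diracE; case: ifPn => [_|_]; last by rewrite eseries0.
apply/esym/eqyP => A A0.
pose n := (Num.truncn A).+1.
apply: (@le_trans _ _ (\sum_(0 <= i < n) 1%:E)%E); last first.
  by apply: nneseries_lim_ge => i _ _; exact: lee01.
rewrite big_mkord sumEFin lee_fin sumr_const card_ord.
exact/ltW/truncnS_gt.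
Qed.

(** The part of m carried by x0 is always s-finite: it is a finite measure, or else an infinite sum
    of Dirac masses. *)
Lemma sfinite_measure_setC1 m (x0 : T) (m0 : measurable [set x0]) :
  sfinite_measure (mrestr m (measurableC m0)) -> sfinite_measure m.
Proof.
move=> [s sfin sE].
have [t tfin tE] : sfinite_measure (mrestr m m0).
  have mE (U : set T) : mrestr m m0 U = (if x0 \in U then m [set x0] else 0)%E.
    rewrite /mrestr; case: ifPn => [/set_mem Ux|/negP nU].
      by congr (m _); apply/seteqP; split => [x []//|x /= ->].
    rewrite (_ : _ `&` _ = set0) ?measure0//.
    by apply/seteqP; split => // x [/= Ux xx]; apply: nU; rewrite -xx;
      exact: mem_set.
  have [mfin|] := boolP (m [set x0] \is a fin_num).
    apply: sfinite_measure_sigma_finite; apply: fin_num_fun_sigma_finite.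
      by rewrite measure0 ltry.
    by move=> U mU; rewrite /= mE; case: ifP.
  rewrite ge0_fin_numE// -leNgt leye_eq => /eqP moo.
  have [t tfin tE] := sfinite_dirac_infty x0.
  by exists t => // U mU; rewrite mE moo -tE.
pose u n : {measure set T -> \bar R} := measure_add (s n) (t n).
have uE n U : u n U = (s n U + t n U)%E by exact: measure_addE.
exists u => [n U mU|U mU].
  by rewrite uE fin_numD (sfin n U mU) (tfin n U mU).
rewrite /mseries; under eq_eseriesr do rewrite uE.
rewrite nneseriesD//; have := sE U mU; have := tE U mU.
rewrite /mseries => <- <-; rewrite /mrestr -setDE.
exact: measureDI.
Qed.

End sfinite_complements.

(** * Measures as kernels *)

Section constant_kernel.
Context {dX dY} {X : measurableType dX} {Y : measurableType dY} {R : realType}.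

(** A measure seen as a kernel that ignores its source point, so that products of measures become
    compositions of kernels. *)
Definition kcst (m : {measure set Y -> \bar R}) (_ : X) :
  {measure set Y -> \bar R} := m.

Let measurable_kcst m U : measurable U -> measurable_fun [set: X] (kcst m ^~ U).
Proof. by move=> mU; exact: measurable_cst. Qed.

HB.instance Definition _ m :=
  isKernel.Build _ _ X Y R (kcst m) (measurable_kcst m).

Lemma kcst_sfkernel (m : {measure set Y -> \bar R}) : sfinite_measure m ->
  exists k : R.-sfker X ~> Y, forall x, k x = m.
Proof.
move=> [s sfin sE].
have uub n : measure_fam_uub (kcst (s n)).
  have := sfin n setT measurableT; rewrite ge0_fin_numE// => lty.
  exists (fine (s n setT) + 1) => x; rewrite /kcst EFinD fineK ?ge0_fin_numE//.
  by rewrite lteDl ?lte01// ge0_fin_numE.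
have sf : exists2 k_ : (R.-ker X ~> Y)^nat, forall n, measure_fam_uub (k_ n) &
    forall x U, measurable U -> kcst m x U = kseries k_ x U.
  exists (fun n => kcst (s n)) => // x U mU; exact: sE.
pose H := isSFiniteKernel_subdef.Build _ _ X Y R (kcst m) sf.
pose k : R.-sfker X ~> Y := HB.pack (kcst m) H.
by exists k.
Qed.

End constant_kernel.

(** * Products of the entries of a tuple *)

Section mprod_measurability.
Context {R : realType} {d : nat}.
Implicit Types (w v : 'M[R[i]]_d).

(** The head of the tuple acts first and therefore stands on the right. This matches [mpower], which
    also splits off the head. *)
Lemma mprod_cons n v (t : n.-tuple 'M[R[i]]_d) :
  mprod [tuple of v :: t] = mprod t *m v.
Proof.
have foldlE (l : seq 'M[R[i]]_d) (a : 'M[R[i]]_d) :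
    foldl (fun w u => u *m w) a l = foldl (fun w u => u *m w) 1%:M l *m a.
  elim: l a => [|u l ih] a /=; first by rewrite mul1mx.
  by rewrite ih [in RHS]ih mulmx1 mulmxA.
by rewrite /mprod /= mulmx1 foldlE.
Qed.

Lemma measurable_mprod n :
  measurable_fun [set: n.-tuple (Mborel R d)] (@mprod R d n : _ -> Mborel R d).
Proof.
elim: n => [|n ih].
  rewrite (_ : mprod (n:=0) = cst (1%:M : Mborel R d)); first exact: measurable_cst.
  by apply/funext => t; rewrite (tuple0 t).
rewrite (_ : mprod (n:=n.+1) = fun t : n.+1.-tuple (Mborel R d) =>
    (mprod [tuple of behead t] : 'M[R[i]]_d) *m (thead t : 'M[R[i]]_d)).
  apply: measurable_mulmx; last exact: measurable_tnth.
  by apply: (measurableT_comp ih); exact: measurable_behead.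
by apply/funext => t; rewrite [t in LHS]tuple_eta mprod_cons.
Qed.

End mprod_measurability.

(** * Integration of functions of v_n ... v_1 *)

Section product_measure.
Context {R : realType} {d : nat} {mu : {measure set (Mborel R d) -> \bar R}}.
Hypothesis sfmu : sfinite_measure mu.
Implicit Types (D : Mborel R d -> R).

(** The factor [unit] is the source point that the composition of kernels carries along. *)
Lemma measurable_pair_cons n : measurable_fun
  [set: (unit * Mborel R d) * n.-tuple (Mborel R d)]
  (fun p => [tuple of p.1.2 :: p.2] : n.+1.-tuple (Mborel R d)).
Proof.
by apply: measurable_cons => //;
  apply: (measurableT_comp measurable_snd measurable_fst).
Qed.

(* [mu] need not be sigma-finite, which rules out the library's Fubini theorem
   for [\x]; [mpower] is instead identified with a composition of s-finite
   kernels. *)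
Lemma mpowerS_kernel n (m : {measure set (n.-tuple (Mborel R d)) -> \bar R}) :
  sfinite_measure m -> (forall A, measurable A -> mpower mu n A = m A) ->
  exists k : R.-sfker unit ~> n.+1.-tuple (Mborel R d),
    [/\ forall A, measurable A -> mpower mu n.+1 A = k tt A,
     forall F : n.+1.-tuple (Mborel R d) -> \bar R,
      measurable_fun setT F -> (forall t, 0 <= F t)%E ->
      measurable_fun setT (fun v => \int[mpower mu n]_w F [tuple of v :: w])%E &
     forall F : n.+1.-tuple (Mborel R d) -> \bar R,
      measurable_fun setT F -> (forall t, 0 <= F t)%E ->
      (\int[mpower mu n.+1]_t F t =
       \int[mu]_v \int[mpower mu n]_w F [tuple of v :: w])%E].
Proof.
move=> sfm mE.
have [kmu kmuE] := @kcst_sfkernel _ _ unit _ R mu sfmu.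
have [km kmE] := @kcst_sfkernel _ _ (unit * Mborel R d)%type _ R m sfm.
pose kc : R.-sfker (unit * Mborel R d) * n.-tuple (Mborel R d) ~>
  n.+1.-tuple (Mborel R d) := kdirac (measurable_pair_cons n).
pose kk : R.-sfker (unit * Mborel R d) ~> n.+1.-tuple (Mborel R d) := (km \; kc)%E.
pose k : R.-sfker unit ~> n.+1.-tuple (Mborel R d) := (kmu \; kk)%E.
have kkE F v : measurable_fun setT F -> (forall t, 0 <= F t)%E ->
    (\int[kk (tt, v)]_t F t = \int[mpower mu n]_w F [tuple of v :: w])%E.
  move=> mF F0; rewrite integral_kcomp// kmE (eq_integral_setfun _ _ _ mE).
  apply: eq_integral => w _; rewrite /= integral_dirac//.
  by rewrite diracT mul1e.
have kpE A : measurable A -> mpower mu n.+1 A = k tt A.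
  move=> mA; rewrite /= /kcomp kmuE /pushforward /product_measure1 /=.
  have mpre v : measurable [set w : n.-tuple (Mborel R d) | A [tuple of v :: w]].
    have := @measurable_cons _ _ (n.-tuple (Mborel R d)) (Mborel R d) (fun=> v) n
      id (measurable_cst _) (@measurable_id _ _ _) measurableT A mA.
    by rewrite setTI.
  apply: eq_integral => v _;
    transitivity (m [set w : n.-tuple (Mborel R d) | A [tuple of v :: w]]).
    rewrite -mE//; congr (mpower _ _ _).
    by apply/seteqP; split => w /=; rewrite /xsection /= inE.
  by rewrite /kcomp kmE -[X in m X]setIT -integral_indic.
exists k; split => // F mF F0.
  under eq_fun => v do rewrite -kkE//.
  apply: (@measurable_fun_integral_kernel _ _ _ _ _ (fun v => kk (tt, v))) =>
    // U mU.
  apply: (measurableT_comp (measurable_kernel kk U mU)).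
  exact: pair1_measurable.
rewrite (eq_integral_setfun _ _ _ kpE) integral_kcomp// kmuE.
by apply: eq_integral => v _; exact: kkE.
Qed.

Lemma mpower_sfinite n : exists m : {measure set (n.-tuple (Mborel R d)) -> \bar R},
  sfinite_measure m /\ forall A, measurable A -> mpower mu n A = m A.
Proof.
elim: n => [|n [m [sfm mE]]].
  by exists \d_([tuple] : 0.-tuple (Mborel R d)); split => //; exact: s_finite.
have [k [kE _ _]] := mpowerS_kernel n m sfm mE.
by exists (k tt); split => //; exact: sfinite_kernel_measure.
Qed.

(** Only functions of the product v_n ... v_1 have to be integrated. Splitting off v_1 then amounts
    to replacing D by w |-> D(w v_1), as in [mpower_integralS]. *)
Definition mpower_integral n D : \bar R :=
  (\int[mpower mu n]_t (D (mprod t))%:E)%E.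

Local Notation J := mpower_integral.

Lemma mpower_integral0 D : measurable_fun setT D -> J 0 D = (D 1%:M)%:E.
Proof.
move=> mD; rewrite /J /= integral_dirac//.
  by rewrite diracT mul1e.
apply/measurable_EFinP; exact: measurableT_comp mD (measurable_mprod 0).
Qed.

Lemma mpower_integral_ge0 n D : (forall w, 0 <= D w) -> (0 <= J n D)%E.
Proof.
have [m [_ mE]] := mpower_sfinite n => D0.
rewrite /J (eq_integral_setfun _ _ _ mE); apply: integral_ge0 => t _.
by rewrite lee_fin.
Qed.

Let mJ n D : measurable_fun setT D ->
  measurable_fun [set: n.-tuple (Mborel R d)] (fun t => (D (mprod t))%:E).
Proof.
by move=> mD; apply/measurable_EFinP;
  exact: measurableT_comp mD (measurable_mprod n).
Qed.

Lemma le_mpower_integral n D1 D2 : measurable_fun setT D1 ->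
  measurable_fun setT D2 -> (forall w, 0 <= D1 w) -> (forall w, D1 w <= D2 w) ->
  (J n D1 <= J n D2)%E.
Proof.
move=> m1 m2 D10 D12; have [m [_ mE]] := mpower_sfinite n.
rewrite /J !(eq_integral_setfun _ _ _ mE); apply: ge0_le_integral => //.
- by move=> t _; rewrite lee_fin.
- exact: mJ.
- exact: mJ.
- by move=> t _; rewrite lee_fin.
Qed.

Lemma mpower_integralD n D1 D2 : measurable_fun setT D1 ->
  measurable_fun setT D2 -> (forall w, 0 <= D1 w) -> (forall w, 0 <= D2 w) ->
  J n (fun w => D1 w + D2 w) = (J n D1 + J n D2)%E.
Proof.
move=> m1 m2 D10 D20; have [m [_ mE]] := mpower_sfinite n.
rewrite /J !(eq_integral_setfun _ _ _ mE) -ge0_integralD//.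
- by move=> t _; rewrite lee_fin.
- exact: mJ.
- by move=> t _; rewrite lee_fin.
- exact: mJ.
Qed.

Lemma mpower_integralZ n c D : measurable_fun setT D ->
  (forall w, 0 <= D w) -> 0 <= c -> J n (fun w => c * D w) = (c%:E * J n D)%E.
Proof.
move=> mD D0 c0; have [m [_ mE]] := mpower_sfinite n.
rewrite /J !(eq_integral_setfun _ _ _ mE) -ge0_integralZl//.
- exact: mJ.
- by move=> t _; rewrite lee_fin.
Qed.

Lemma measurable_mulr v D : measurable_fun setT D ->
  measurable_fun setT (fun w : Mborel R d => D ((w : 'M[R[i]]_d) *m v)).
Proof.
move=> mD; apply: (measurableT_comp mD); exact: measurable_mulmx.
Qed.

Let J_cons n D (v : 'M[R[i]]_d) :
  (\int[mpower mu n]_w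
     (D (mprod ([tuple of v :: w] : n.+1.-tuple (Mborel R d))))%:E)%E =
  J n (fun w => D ((w : 'M[R[i]]_d) *m v)).
Proof. by congr integral; apply/funext => w; rewrite mprod_cons. Qed.

Lemma measurable_mpower_integral n D : measurable_fun setT D ->
  (forall w, 0 <= D w) ->
  measurable_fun setT (fun v : Mborel R d =>
    J n (fun w => D ((w : 'M[R[i]]_d) *m (v : 'M[R[i]]_d)))).
Proof.
move=> mD D0; have [m [sfm mE]] := mpower_sfinite n.
have [k [_ kM _]] := mpowerS_kernel n m sfm mE.
have := kM _ (mJ n.+1 D mD) ltac:(by move=> t; rewrite lee_fin).
under eq_fun => v do rewrite J_cons.
exact.
Qed.

Lemma mpower_integralS n D : measurable_fun setT D -> (forall w, 0 <= D w) ->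
  J n.+1 D =
  (\int[mu]_v J n (fun w => D ((w : 'M[R[i]]_d) *m (v : 'M[R[i]]_d))))%E.
Proof.
move=> mD D0; have [m [sfm mE]] := mpower_sfinite n.
have [k [_ _ kI]] := mpowerS_kernel n m sfm mE.
rewrite /J kI; [|exact: mJ|by move=> t; rewrite lee_fin].
by apply: eq_integral => v _; exact: J_cons.
Qed.



End product_measure.

(* [mu] is sigma-finite off 0, and mu({0}) = +oo is an infinite sum of Dirac
   measures. *)
Lemma sfinite_moment {R : realType} {d : nat}
    (mu : {measure set (Mborel R d) -> \bar R}) (s : R) : 0 < s ->
  (\int[mu]_v (opnorm v `^ s)%:E < +oo)%E -> sfinite_measure mu.
Proof.
move=> s0 mus.
have m_opnorm (A : set R) : measurable A ->
    measurable [set w : Mborel R d | A (opnorm w)].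
  by move=> mA; have := @measurable_opnorm R d measurableT A mA; rewrite setTI.
have E0 : [set (0 : 'M[R[i]]_d)] = [set w : Mborel R d | opnorm w \in `]-oo, 0]].
  apply/seteqP; split => w /=.
    move=> ->; rewrite in_itv /=; apply: le_trans (opnorm_le_cols _) _.
    by rewrite big1// => j _; rewrite col0 enorm0.
  rewrite in_itv /= => w0; apply: opnorm_eq0.
  by apply/eqP; rewrite eq_le w0 opnorm_ge0.
have m0 : measurable [set (0 : Mborel R d)].
  by rewrite E0; apply: (m_opnorm [set` `]-oo, 0]]).
apply: (@sfinite_measure_setC1 _ _ _ mu 0 m0).
apply: sfinite_measure_sigma_finite.
(* By Markov's inequality for |v|^s, each G n has finite measure. Adding {0} makes these sets cover
   the space, and the restricted measure gives {0} no mass. *)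
pose G n := [set w : Mborel R d | n.+1%:R^-1 <= opnorm w].
have mG n : measurable (G n).
  have := m_opnorm [set` `[n.+1%:R^-1, +oo[] (measurable_itv _).
  by congr measurable; apply/seteqP; split => w /=; rewrite in_itv /= andbT.
exists (fun n => [set 0] `|` G n).
  apply/seteqP; split => // w _.
  have [->|w0] := eqVneq (w : 'M[R[i]]_d) 0; first by exists 0%N => //; left.
  have ow : 0 < opnorm w.
    rewrite lt_neqAle opnorm_ge0 andbT eq_sym.
    by apply: contra_neq w0 => /opnorm_eq0.
  have [n _ /(_ n (leqnn n)) /= nw] := near_infty_natSinv_lt (PosNum ow).
  by exists n => //; right; exact: ltW.
move=> n; split; first exact: measurableU.
rewrite /= /mrestr setIUl setICr set0U.
have mGs := measurableT_comp (measurable_powR s) (@measurable_opnorm R d).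
pose c : R := n.+1%:R^-1 `^ s.
have c0 : 0 < c by rewrite powR_gt0.
have GE : G n `<=` setT `&` [set w : Mborel R d | (c%:E <= `|(opnorm w `^
  s)%:E|)%E].
  move=> w Gw; split=> //=; rewrite lee_fin ger0_norm ?powR_ge0//.
  by apply: ge0_ler_powR; rewrite ?nnegrE ?opnorm_ge0 ?(ltW s0).
have mH : measurable (setT `&` [set w : Mborel R d | (c%:E <= `|(opnorm w `^
  s)%:E|)%E]).
  apply: emeasurable_fun_c_infty => //; apply: measurableT_comp => //.
  exact/measurable_EFinP.
have := @le_integral_comp_abse _ _ _ mu setT measurableT
  (fun w => (opnorm w `^ s)%:E) c id (@measurable_id _ _ _) (fun _ h => h)
  (fun _ _ _ _ h => h).
move=> /(_ ltac:(exact/measurable_EFinP) c0) h.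
apply: (@le_lt_trans _ _ (mu (G n))).
  apply: le_measure; rewrite ?inE//.
  by apply: measurableI => //; exact: measurableC.
suff : (c%:E * mu (G n) < +oo)%E.
  have [->|] := eqVneq (mu (G n)) +oo%E; last by rewrite -ltey.
  by rewrite gt0_muley// lte_fin.
apply: (le_lt_trans _ mus); apply: le_trans (le_trans h _) => /=.
  by rewrite lee_pmul2l// le_measure ?inE.
rewrite le_eqVlt; apply/orP; left; apply/eqP; apply: eq_integral => w _.
by rewrite /= ger0_norm ?powR_ge0.
Qed.

(** * The transfer operator *)

Section transfer_operator.
Context {R : realType} {d : nat} {mu : {measure set (Mborel R d) -> \bar R}}.
Context {s a : R} {m : nat}.
Hypotheses (a01 : 0 < a <= 1) (as2 : 2 * a < s) (sm : s <= m%:R * a).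
Hypothesis mus : (\int[mu]_v (opnorm v `^ s)%:E < +oo)%E.
Implicit Types (f g : pspace R d -> R) (w v : 'M[R[i]]_d) (X Y U V : 'cV[R[i]]_d).
Implicit Types (L : pspace R d) (K H : R) (D : Mborel R d -> R).

Let a0 : 0 < a. Proof. by case/andP: a01. Qed.
Let s0 : 0 < s. Proof. by move: a0 as2; lra. Qed.
Let sfmu : sfinite_measure mu. Proof. exact: sfinite_moment s0 mus. Qed.
Local Notation hom := (hom s).
Local Notation J := (@mpower_integral R d mu).

(** Since V /\ U = (V - U) /\ U, both terms of [hom_estimate] are of order |V - U|^a near U.
    Continuity of the extension yields Borel measurability of v |-> F(vX). *)
Lemma hom_cont K H f : 0 <= K -> 0 <= H -> holderc a K H f ->
  forall U e, 0 < e -> exists2 r : R, 0 < r &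
    forall V, enorm (V - U) < r -> `|hom f V - hom f U| < e.
Proof.
move=> K0 H0 fP U e e0.
pose N := enorm U + 1; have N0 : 0 < N by rewrite ltr_wpDl ?enorm_ge0.
pose c := (H + K * m%:R) * N `^ (s - a) + 1.
have c0 : 0 < c by rewrite ltr_wpDl// mulr_ge0 ?addr_ge0 ?mulr_ge0 ?powR_ge0.
pose t := (e / c) `^ a^-1.
have ec0 : 0 < e / c by rewrite divr_gt0.
have t0 : 0 < t by rewrite powR_gt0.
have tE : t `^ a = e / c by rewrite -powRrM mulVf ?gt_eqF// powRr1// ltW.
exists (Num.min 1 t) => [|V]; first by rewrite lt_min ltr01.
rewrite lt_min => /andP[VU1 VUt].
have VN : enorm V <= N.
  rewrite -(subrK U V); apply: le_trans (enormD _ _) _.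
  by rewrite addrC lerD2l ltW.
have UN : enorm U <= N by rewrite lerDl.
apply: le_lt_trans (hom_estimate _ _ _ _ _ _ _ _ _ a01 as2 sm K0 H0 fP VN UN) _.
set x := enorm (V - U); have x0 : 0 <= x by exact: enorm_ge0.
have wx : wnorm (wedge V U) <= x * N.
  have -> : wedge V U = wedge (V - U) U.
    by apply/matrixP => i j; rewrite !wedge_entry !mxE; ring.
  apply: le_trans (wnorm_wedge_le _ _) _.
  by rewrite ler_wpM2l.
have pw (y z : R) : 0 <= y -> y <= z -> y `^ a <= z `^ a.
  by move=> y0 yz; apply: ge0_ler_powR; rewrite ?nnegrE ?(ltW a0)// (le_trans y0).
apply: (@le_lt_trans _ _ ((H + K * m%:R) * N `^ (s - a) * x `^ a)).
  have -> : (H + K * m%:R) * N `^ (s - a) * x `^ a =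
      H * N `^ (s - a) * x `^ a + K * (m%:R * N `^ (s - a) * x `^ a) by ring.
  apply: lerD.
    rewrite -!mulrA ler_wpM2l//.
    have -> : N `^ (s - a) = N `^ a * N `^ (s - 2 * a).
      rewrite -powRD; last by rewrite (gt_eqF N0) implybT.
      by congr (_ `^ _); ring.
    rewrite mulrAC -powRM ?(ltW N0)// ler_wpM2r ?powR_ge0// mulrC.
    by apply: pw; rewrite ?wnorm_ge0.
  rewrite -!mulrA; do 3 (apply: ler_wpM2l; rewrite ?ler0n ?powR_ge0//).
  by apply: pw; rewrite ?normr_ge0 ?enormB_le.
have xa : x `^ a < e / c by rewrite -tE; apply: gt0_ltr_powR;
  rewrite ?nnegrE ?(ltW t0).
apply: (@le_lt_trans _ _ (c * x `^ a)).
  by rewrite ler_wpM2r ?powR_ge0// /c lerDl.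
by rewrite mulrC -ltr_pdivlMr.
Qed.

Lemma measurable_hom K H f X : 0 <= K -> 0 <= H -> holderc a K H f ->
  measurable_fun [set: Mborel R d] (fun v => hom f (v *m X)).
Proof.
by move=> K0 H0 fP; apply: measurable_mulmx_cont; exact: hom_cont K0 H0 fP.
Qed.

Lemma measurable_opnorm_powR (r : R) :
  measurable_fun [set: Mborel R d] (fun v => opnorm v `^ r).
Proof. exact: measurableT_comp (measurable_powR r) measurable_opnorm. Qed.

Lemma integrable_opnorm_bound (F : Mborel R d -> R) c :
  measurable_fun setT F -> (forall v, `|F v| <= c * opnorm v `^ s) ->
  mu.-integrable setT (EFin \o F).
Proof.
move=> mF Fc.
have iop : mu.-integrable setT (EFin \o (fun v => c * opnorm v `^ s)).
  have := @integrableZl _ _ _ mu setT measurableT c (EFin \o fun v => opnorm v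
    `^ s).
  apply; apply/integrableP; split.
    by apply/measurable_EFinP; exact: measurable_opnorm_powR.
  apply: le_lt_trans mus; rewrite le_eqVlt; apply/orP; left; apply/eqP.
  by apply: eq_integral => v _; rewrite /= ger0_norm ?powR_ge0.
apply: le_integrable iop => //; first exact/measurable_EFinP.
move=> v _; rewrite /= lee_fin; apply: le_trans (Fc v) _; exact: ler_norm.
Qed.

Lemma hom_mul_bound K f w X : (forall L, `|f L| <= K) ->
  `|hom f (w *m X)| <= K * enorm X `^ s * opnorm w `^ s.
Proof.
move=> fK; apply: le_trans (hom_bound _ _ _ _ s0 fK) _.
have [->|X0] := eqVneq X 0.
  by rewrite mulmx0 enorm0 powR0 ?gt_eqF// !(mulr0,mul0r).
have [L [lX _]] := lineP _ X0.
rewrite -mulrA ler_wpM2l ?(le_trans (normr_ge0 _) (fK L))//.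
rewrite mulrC -powRM ?opnorm_ge0 ?enorm_ge0//; apply: ge0_ler_powR.
- exact: ltW.
- by rewrite nnegrE enorm_ge0.
- by rewrite nnegrE mulr_ge0 ?opnorm_ge0 ?enorm_ge0.
- exact: enorm_mul.
Qed.

Lemma integrable_hom K H f X : 0 <= K -> 0 <= H -> holderc a K H f ->
  mu.-integrable setT (EFin \o fun v => hom f (v *m X)).
Proof.
move=> K0 H0 fP; apply: integrable_opnorm_bound.
  exact: measurable_hom K0 H0 fP.
by move=> v; apply: hom_mul_bound; exact: fP.1.
Qed.

Definition transfer f L : R := \int[mu]_v hom f (v *m urep L).

(** Both sides are multiplied by |z|^s when X is replaced by zX, so the formula extends from the
    chosen representatives to all vectors, and iteration takes place without renormalizing. *)
Lemma hom_transfer K H f X : 0 <= K -> 0 <= H -> holderc a K H f ->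
  hom (transfer f) X = \int[mu]_v hom f (v *m X).
Proof.
move=> K0 H0 fP; have [->|/lineP[L [lX [z zE]]]] := eqVneq X 0.
  rewrite hom0; under eq_Rintegral do rewrite mulmx0 hom0.
  by rewrite Rintegral_cst// mul0r.
rewrite {1}zE homZ// hom_urep /transfer -RintegralZl//; last first.
  exact: integrable_hom K0 H0 fP.
apply: eq_Rintegral => v _.
have -> : v *m X = z *: (v *m urep L) by rewrite zE; exact/esym/scalemxAr.
by rewrite [RHS]homZ.
Qed.

(* The factor 2 is a bound for 2^a, with the 2 of [phase_align]. *)
Definition hbound K H w : R :=
  H * (wedge2_norm w `^ a * opnorm w `^ (s - 2 * a)) +
  K * m%:R * 2 * opnorm w `^ s.

Lemma hbound_ge0 K H w : 0 <= K -> 0 <= H -> 0 <= hbound K H w.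
Proof. by move=> K0 H0; rewrite addr_ge0 ?mulr_ge0 ?powR_ge0. Qed.

(** From |wedge^2 w| <= |w|^2. It makes the integral in h_a(n) finite once that of |w|^s is. *)
Lemma wedge2_powR_le w :
  wedge2_norm w `^ a * opnorm w `^ (s - 2 * a) <= opnorm w `^ s.
Proof.
have -> : opnorm w `^ s = (opnorm w ^+ 2) `^ a * opnorm w `^ (s - 2 * a).
  rewrite -powR_mulrn ?opnorm_ge0// -powRrM -powRD.
    by congr (_ `^ _); ring.
  by rewrite addrC subrK gt_eqF.
rewrite ler_wpM2r ?powR_ge0//; apply: ge0_ler_powR.
- exact: ltW.
- by rewrite nnegrE wedge2_norm_ge0.
- by rewrite nnegrE sqr_ge0.
- exact: wedge2_norm_le.
Qed.

Lemma measurable_wedge2_powR : measurable_fun [set: Mborel R d]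
  (fun w => wedge2_norm w `^ a * opnorm w `^ (s - 2 * a)).
Proof.
apply: measurable_funM; last exact: measurable_opnorm_powR.
exact: measurableT_comp (measurable_powR a) measurable_wedge2_norm.
Qed.

Lemma measurable_hbound K H : measurable_fun [set: Mborel R d] (hbound K H).
Proof.
apply: measurable_funD; apply: measurable_funM => //.
  exact: measurable_wedge2_powR.
exact: measurable_opnorm_powR.
Qed.

Lemma hbound_le K H w : 0 <= K -> 0 <= H ->
  hbound K H w <= (H + K * m%:R * 2) * opnorm w `^ s.
Proof. by move=> K0 H0; rewrite mulrDl lerD2r ler_wpM2l ?wedge2_powR_le. Qed.

(** The phase z is chosen before w and the distance is factored out, so integrating over w leaves a
    multiple of d(L1, L2)^a. *)
Lemma hom_hbound K H f L1 L2 : 0 <= K -> 0 <= H -> holderc a K H f ->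
  exists2 z, cmod z = 1 & forall w,
  `|hom f (w *m urep L1) - hom f (w *m (z *: urep L2))| <=
    pdist L1 L2 `^ a * hbound K H w.
Proof.
move=> K0 H0 fP; have [z z1 zd] := phase_align L1 L2; exists z => // w.
set X := urep L1; set Y := z *: urep L2; set p := pdist L1 L2.
have nX : enorm X = 1 by exact: enorm_urep.
have nY : enorm Y = 1 by rewrite enormZ z1 enorm_urep mul1r.
have p0 : 0 <= p by exact: pdist_ge0.
have le_op V : enorm V = 1 -> enorm (w *m V) <= opnorm w.
  by move=> V1; apply: le_trans (enorm_mul _ _) _; rewrite V1 mulr1.
apply: le_trans (hom_estimate _ _ _ _ _ _ _ _ _ a01 as2 sm K0 H0 fP (le_op X
  nX) (le_op Y nY)) _.
rewrite mulrDr; apply: lerD.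
  rewrite [leRHS]mulrCA -mulrA ler_wpM2l// mulrA ler_wpM2r ?powR_ge0//.
  rewrite -powRM ?wedge2_norm_ge0//.
  apply: ge0_ler_powR; rewrite ?nnegrE ?wnorm_ge0 ?mulr_ge0 ?wedge2_norm_ge0
    ?(ltW a0)//.
  rewrite -wedge2_wedge;
    apply: le_trans (wedge2_norm_ge _ _ (wedge_in_space _ _)) _.
  rewrite mulrC ler_wpM2r ?wedge2_norm_ge0// /X /Y -[urep L1]scale1r wedgeZ mul1r.
  by rewrite wnormZ z1 mul1r -pdistE.
have xw : `|enorm (w *m X) - enorm (w *m Y)| <= opnorm w * (2 * p).
  apply: le_trans (enormB_le _ _) _; rewrite -mulmxBr.
  by apply: le_trans (enorm_mul _ _) _; rewrite ler_wpM2l ?opnorm_ge0.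
have xwa : `|enorm (w *m X) - enorm (w *m Y)| `^ a <= opnorm w `^ a * (2 * p `^ a).
  apply: (@le_trans _ _ ((opnorm w * (2 * p)) `^ a)).
    by apply: ge0_ler_powR; rewrite ?nnegrE ?mulr_ge0 ?opnorm_ge0 ?(ltW a0).
  rewrite !powRM ?mulr_ge0 ?opnorm_ge0// ler_wpM2l ?powR_ge0//.
  rewrite ler_wpM2r ?powR_ge0// ler1_powR ?ler1n//; by case/andP: a01.
have -> : p `^ a * (K * m%:R * 2 * opnorm w `^ s) =
    K * (m%:R * opnorm w `^ (s - a) * (opnorm w `^ a * (2 * p `^ a))).
  have -> : opnorm w `^ s = opnorm w `^ (s - a) * opnorm w `^ a.
    by rewrite -powRD ?subrK// gt_eqF.
  by ring.
by do 2 (apply: ler_wpM2l; rewrite ?mulr_ge0 ?ler0n ?powR_ge0//).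
Qed.

(** G is extended-valued because it will be an integral over products whose finiteness is not yet
    known. *)
Lemma norm_Rintegral_le (F : Mborel R d -> R) (G : Mborel R d -> \bar R) :
  mu.-integrable setT (EFin \o F) -> measurable_fun setT G ->
  (forall v, (`|F v|%:E <= G v)%E) ->
  (`|\int[mu]_v F v|%:E <= \int[mu]_v G v)%E.
Proof.
move=> iF mG FG.
have /integrableP[mF _] := iF.
apply: (@le_trans _ _ (\int[mu]_v `|(F v)%:E|)%E).
  rewrite EFin_normr_Rintegral//.
  exact: le_abse_integral.
apply: ge0_le_integral => //.
  by apply: measurableT_comp.
by move=> v _; exact: FG.
Qed.

Let M : R := fine (\int[mu]_v (opnorm v `^ s)%:E).

Let ME : (M%:E = \int[mu]_v (opnorm v `^ s)%:E)%E.
Proof.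
rewrite /M fineK// ge0_fin_numE//; apply: integral_ge0 => v _.
by rewrite lee_fin powR_ge0.
Qed.

Lemma transfer_bound c (F : Mborel R d -> R) : measurable_fun setT F -> 0 <= c ->
  (forall v, `|F v| <= c * opnorm v `^ s) -> `|\int[mu]_v F v| <= c * M.
Proof.
move=> mF c0 Fc; rewrite -lee_fin EFinM ME -ge0_integralZl//.
- apply: norm_Rintegral_le.
  + exact: integrable_opnorm_bound Fc.
  + apply/measurable_EFinP; apply: measurable_funM => //.
    exact: measurable_opnorm_powR.
  + by move=> v; rewrite lee_fin.
- by apply/measurable_EFinP; exact: measurable_opnorm_powR.
- by move=> v _; rewrite lee_fin powR_ge0.
Qed.

Lemma holderc_transfer K H f : 0 <= K -> 0 <= H -> holderc a K H f ->
  exists K' H', [/\ 0 <= K', 0 <= H' & holderc a K' H' (transfer f)].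
Proof.
move=> K0 H0 fP.
have M0 : 0 <= M.
  by rewrite fine_ge0// integral_ge0// => v _; rewrite lee_fin powR_ge0.
exists (K * M), ((H + K * m%:R * 2) * M).
split; rewrite ?mulr_ge0 ?addr_ge0 ?mulr_ge0//; split=> [L|L1 L2].
  apply: transfer_bound => //; first exact: measurable_hom K0 H0 fP.
  move=> v; have := hom_mul_bound K f v (urep L) fP.1.
  by rewrite enorm_urep powR1 mulr1.
have [z z1 zD] := hom_hbound K H f L1 L2 K0 H0 fP.
have -> : transfer f L2 = \int[mu]_v hom f (v *m (z *: urep L2)).
  by rewrite -(hom_transfer K H)// homZ// z1 powR1 mul1r hom_urep.
rewrite -RintegralB//; [|exact: integrable_hom K0 H0 fP..].
rewrite mulrAC; apply: transfer_bound.
- apply: measurable_funB; exact: measurable_hom K0 H0 fP.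
- by rewrite mulr_ge0 ?addr_ge0 ?mulr_ge0 ?powR_ge0.
move=> v; apply: le_trans (zD v) _.
by rewrite mulrC [leRHS]mulrAC ler_wpM2r ?powR_ge0// hbound_le.
Qed.

(** The constants are left unspecified: they only serve measurability and integrability, while the
    quantitative bounds are [iter_transfer_dist] and [iter_transfer_le]. *)
Lemma holderc_iter_transfer n K H f : 0 <= K -> 0 <= H -> holderc a K H f ->
  exists K' H', [/\ 0 <= K', 0 <= H' & holderc a K' H' (iter n transfer f)].
Proof.
move=> K0 H0 fP; elim: n => [|n [K' [H' [K'0 H'0 fn]]]]; first by exists K, H.
exact: holderc_transfer K'0 H'0 fn.
Qed.

(** The dominating function D is arbitrary so that the induction can absorb one matrix: the
    hypothesis for X, Y and D gives the one for vX, vY and w |-> D(w v). *)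
Lemma iter_transfer_dist n K H f X Y D : 0 <= K -> 0 <= H -> holderc a K H f ->
  measurable_fun setT D -> (forall w, 0 <= D w) ->
  (forall w, `|hom f (w *m X) - hom f (w *m Y)| <= D w) ->
  (`|hom (iter n transfer f) X - hom (iter n transfer f) Y|%:E <= J n D)%E.
Proof.
move=> K0 H0 fP; elim: n X Y D => [|n ih] X Y D mD D0 XY.
  by rewrite mpower_integral0// lee_fin; have := XY 1%:M; rewrite !mul1mx.
have [K' [H' [K'0 H'0 fn]]] := holderc_iter_transfer n K H f K0 H0 fP.
rewrite iterS !(hom_transfer K' H')// -RintegralB//;
  [|exact: integrable_hom K'0 H'0 fn..].
rewrite (mpower_integralS sfmu)//; apply: norm_Rintegral_le.
- have iX := integrable_hom _ _ _ X K'0 H'0 fn.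
  have iY := integrable_hom _ _ _ Y K'0 H'0 fn.
  exact: (integrableB measurableT iX iY).
- exact: measurable_mpower_integral.
move=> v; apply: ih => //; first exact: measurable_mulr.
by move=> w; rewrite !mulmxA.
Qed.

End transfer_operator.

(** * The eigenfunction and the normalized operator *)

Section sphere_compactness.
Context {R : realType} {d : nat}.

(** Identifies R^(2d) with C^d, which brings in the compactness of boxes of real row vectors. *)
Definition realify (u : 'rV[R]_(d + d)) : 'cV[R[i]]_d :=
  \col_i (u 0 (lshift d i) +i* u 0 (rshift d i)).

Lemma continuous_realify (F : 'cV[R[i]]_d -> R) :
  (forall U e, 0 < e -> exists2 r : R, 0 < r &
    forall V, enorm (V - U) < r -> `|F V - F U| < e) ->
  continuous (fun u : 'rV[R]_(d + d) => F (realify u)).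
Proof.
move=> cF u; have FF : Filter (nbhs u) by exact: nbhs_filter.
apply/cvgrPdist_lt => e e0.
have [r r0 rF] := cF (realify u) e e0.
pose t : R := r / (d%:R * 2 + 1).
have t0 : 0 < t by rewrite divr_gt0// ltr_wpDl// mulr_ge0.
suff : nbhs u [set v | `|F (realify u) - F (realify v)| < e] by [].
apply/nbhs_ballP; exists t => //= v [_ uv] /=; rewrite distrC; apply: rF.
apply: le_lt_trans (enorm_le_sum _) _.
apply: (@le_lt_trans _ _ (d%:R * (2 * t))).
  apply: sumr_ord_le => i; apply: le_trans (cmod_ReIm _) _; rewrite !mxE /=.
  have := uv 0 (lshift d i); have := uv 0 (rshift d i).
  rewrite /ball /= !(distrC (u _ _)) => h1 h2.
  by rewrite mulr_natl mulr2n lerD// ltW.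
rewrite mulrA /t mulrA ltr_pdivrMr ?ltr_wpDl ?mulr_ge0// mulrC ltr_pM2l//.
by rewrite ltrDl.
Qed.

Lemma continuous_sphere_lower_bound (F : 'cV[R[i]]_d -> R) :
  (forall U e, 0 < e -> exists2 r : R, 0 < r &
    forall V, enorm (V - U) < r -> `|F V - F U| < e) ->
  (forall X, enorm X = 1 -> 0 < F X) ->
  exists2 c : R, 0 < c & forall X, enorm X = 1 -> c <= F X.
Proof.
move=> cF F0.
pose S := [set u : 'rV[R]_(d + d) | enorm (realify u) = 1].
have preS X : enorm X = 1 -> exists2 u, S u & realify u = X.
  move=> X1; pose u : 'rV[R]_(d + d) := row_mx (\row_i complex.Re (X i 0))
    (\row_i complex.Im (X i 0)).
  have uE : realify u = X.
    apply/matrixP => i j; rewrite ord1 !mxE.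
    by rewrite (unsplitK (inl _)) (unsplitK (inr _)) !mxE; case: (X i 0).
  by exists u => //; rewrite /S /= uE.
(* The sphere is empty when d = 0; any positive constant then works. *)
have [[X X1]|nX] := pselect (exists X : 'cV[R[i]]_d, enorm X = 1); last first.
  by exists 1 => // X X1; exfalso; apply: nX; exists X.
have box_compact : compact [set u : 'rV[R]_(d + d) | forall i, `[(-1 : R),
  1]%classic (u ord0 i)].
  by apply: (@rV_compact R (d + d) (fun=> `[-1, 1]%classic)) => _;
    exact: segment_compact.
have S_closed : closed S.
  apply: (@closed_comp _ _ (fun u => enorm (realify u)) [set 1]).
    move=> u _; apply: (continuous_realify (@enorm R d)) => U e e0.
    by exists e => // V VU; exact: le_lt_trans (enormB_le _ _) VU.
  exact: closed_eq.
have S_box : S `<=` [set u : 'rV[R]_(d + d) | forall i, `[(-1 : R), 1]%classic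
  (u ord0 i)].
  move=> u u1 i /=; rewrite in_itv /= -ler_norml -u1.
  case: (split_ordP i) => j ->.
    apply: le_trans (cmod_le_enorm _ j); apply: le_trans (Re_cmod _).
    by rewrite mxE.
  apply: le_trans (cmod_le_enorm _ j); apply: le_trans (Im_cmod _).
  by rewrite mxE.
have S_compact : compact S by exact: subclosed_compact S_closed box_compact S_box.
have S0 : S !=set0 by have [u uS _] := preS X X1; exists u.
have [u uS umin] := @EVT_min_rV R (d + d) (fun u => F (realify u)) S S0 S_compact
  (continuous_subspaceT (continuous_realify F cF)).
exists (F (realify u)); first by apply: F0; exact: (set_mem uS).
by move=> Y /preS[v vS <-]; apply: umin; exact: mem_set.
Qed.

End sphere_compactness.

(** * Growth of the moments and the estimate for real functions *)

Section eigenfunction.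
Context {R : realType} {d : nat} {mu : {measure set (Mborel R d) -> \bar R}}.
Context {s a : R} {m : nat}.
Hypotheses (a01 : 0 < a <= 1) (as2 : 2 * a < s) (sm : s <= m%:R * a).
Hypothesis mus : (\int[mu]_v (opnorm v `^ s)%:E < +oo)%E.
Context {e : pspace R d -> R} {Ke He k : R}.
Hypotheses (Ke0 : 0 <= Ke) (He0 : 0 <= He) (eP : holderc a Ke He e).
Hypothesis e0 : forall L, 0 < e L.
Implicit Types (f g phi : pspace R d -> R) (w v : 'M[R[i]]_d) (X : 'cV[R[i]]_d).
Implicit Types (L : pspace R d) (K H : R) (D : Mborel R d -> R).

Let a0 : 0 < a. Proof. by case/andP: a01. Qed.
Let s0 : 0 < s. Proof. by move: a0 as2; lra. Qed.
Let sfmu : sfinite_measure mu. Proof. exact: sfinite_moment s0 mus. Qed.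
Local Notation hom := (hom s).
Local Notation J := (@mpower_integral R d mu).
Local Notation T := (@transfer R d mu s).

(** Compactness is used on the unit sphere of C^d, for the continuous function [hom e], in place of
    a topology on [pspace]. *)
Lemma eigenfunction_lower_bound : exists2 c : R, 0 < c & forall L, c <= e L.
Proof.
have [|c c0 cP] := @continuous_sphere_lower_bound R d (hom e) (hom_cont a01 as2
  sm _ _ _ Ke0 He0 eP).
  move=> X X1; have X0 : X != 0 by rewrite -enorm_gt0 X1.
  have [L [lX _]] := lineP _ X0.
  by rewrite /hom lX X1 powR1 mulr1.
by exists c => // L; rewrite -(hom_urep s e L) cP// enorm_urep.
Qed.

Hypotheses (k0 : 0 < k) (Te : forall L, T e L = k * e L).

Lemma hom_eigenfunction X : \int[mu]_v hom e (v *m X) = k * hom e X.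
Proof.
rewrite -(hom_transfer a01 as2 sm mus Ke He)// -hom_scale.
by congr (hom _ X); apply/funext.
Qed.

Lemma EFin_integral_hom_eigenfunction (c : R) X :
  (\int[mu]_v (c * hom e (v *m X))%:E = (c * (k * hom e X))%:E)%E.
Proof.
have iF := integrable_hom a01 as2 sm mus Ke He e X Ke0 He0 eP.
rewrite -hom_eigenfunction -RintegralZl// fineK//.
apply: integrable_fin_num => //.
exact: (integrableZl measurableT c iF).
Qed.

Lemma measurable_enorm_powR X :
  measurable_fun [set: Mborel R d] (fun w => enorm (w *m X) `^ s).
Proof. exact: measurableT_comp (measurable_powR s) (measurable_enorm_mul X). Qed.

(** One has c |X|^s <= [hom e X], and each integration multiplies [hom e] by k. *)
Lemma mpower_enorm_le c n X : 0 <= c -> (forall L, c <= e L) ->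
  (c%:E * J n (fun w => enorm (w *m X) `^ s)%R <= (k ^+ n * hom e X)%:E)%E.
Proof.
move=> c0 ce; elim: n X => [|n ih] X.
  rewrite mpower_integral0 ?mul1mx; last exact: measurable_enorm_powR.
  by rewrite -EFinM lee_fin expr0 mul1r -hom_cst// hom_le.
have mE := measurable_enorm_powR X.
rewrite (mpower_integralS sfmu)//; last by move=> w; exact: powR_ge0.
rewrite exprSr -mulrA -EFin_integral_hom_eigenfunction -ge0_integralZl//;
  first last.
- by move=> v _; apply: (mpower_integral_ge0 sfmu) => w; exact: powR_ge0.
- exact: (measurable_mpower_integral sfmu n _ mE (fun w => powR_ge0 _ _)).
apply: ge0_le_integral => //.
- move=> v _; apply: mule_ge0; first by rewrite lee_fin.
  by apply: (mpower_integral_ge0 sfmu) => w; exact: powR_ge0.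
- apply: measurable_funeM.
  exact: (measurable_mpower_integral sfmu n _ mE (fun w => powR_ge0 _ _)).
- apply/measurable_EFinP; apply: measurable_funM => //.
  exact: (measurable_hom a01 as2 sm Ke He).
move=> v _; apply: le_trans (ih (v *m X)).
by under eq_fun => w do rewrite -mulmxA.
Qed.

Lemma mpower_integral_sum n (I : Type) (r : seq I) (F : I -> Mborel R d -> R) :
  (forall i, measurable_fun setT (F i)) -> (forall i w, 0 <= F i w) ->
  J n (fun w => \sum_(i <- r) F i w) = (\sum_(i <- r) J n (F i))%E.
Proof.
move=> mF F0; elim: r => [|i r ih].
  rewrite big_nil /mpower_integral.
  under eq_fun do rewrite big_nil.
  have [m' [_ mE]] := mpower_sfinite sfmu n.
  by rewrite (eq_integral_setfun _ _ _ mE) integral0.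
rewrite big_cons -ih -(mpower_integralD sfmu)//.
- by under eq_fun do rewrite big_cons.
- exact: measurable_sum.
- by move=> w; rewrite sumr_ge0.
Qed.

Lemma mpower_opnorm_le : exists2 C : R, 0 <= C &
  forall n, (J n (fun w => opnorm w `^ s)%R <= (C * k ^+ n)%:E)%E.
Proof.
have [c c0 ce] := eigenfunction_lower_bound.
(* The factor d^s comes from [powR_sum_le], d counts the basis vectors, and Ke / c compares the
   upper and lower bounds of e. *)
exists (d%:R `^ s * (d%:R * (Ke / c))) => [|n].
  by rewrite !mulr_ge0 ?powR_ge0// invr_ge0 ltW.
have mE j := measurable_enorm_powR (delta_mx j 0).
apply: (@le_trans _ _ (J n (fun w => d%:R `^ s * \sum_j enorm (w *m delta_mx j
  0) `^ s))).
  apply: (le_mpower_integral sfmu).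
  - exact: measurable_opnorm_powR.
  - by apply: measurable_funM => //; apply: measurable_sum.
  - by move=> w; exact: powR_ge0.
  move=> w; apply: (@le_trans _ _ ((\sum_j enorm (w *m delta_mx j 0)) `^ s)).
    apply: ge0_ler_powR; rewrite ?nnegrE ?opnorm_ge0 ?sumr_ge0 ?(ltW s0)//.
      by move=> j _; exact: enorm_ge0.
    apply: le_trans (opnorm_le_cols w) _.
    by apply: ler_sum => j _; rewrite colE.
  by apply: powR_sum_le => // j; exact: enorm_ge0.
rewrite (mpower_integralZ sfmu); [|exact: measurable_sum| |exact: powR_ge0];
  last first.
  by move=> w; rewrite sumr_ge0// => j _; exact: powR_ge0.
rewrite (mpower_integral_sum n)//; last by move=> j w; exact: powR_ge0.
rewrite -[X in (_ <= X%:E)%E]mulrA EFinM; apply: lee_wpmul2l;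
  first by rewrite lee_fin powR_ge0.
have Jj j : (J n (fun w => enorm (w *m delta_mx j 0) `^ s)%R <= (Ke / c * k ^+
  n)%:E)%E.
  rewrite -(@lee_pmul2l _ c%:E)// -EFinM.
  apply: le_trans (mpower_enorm_le c n _ (ltW c0) ce) _.
  rewrite lee_fin [leRHS](_ : _ = k ^+ n * Ke); last first.
    by field; rewrite gt_eqF.
  rewrite ler_wpM2l ?exprn_ge0 ?(ltW k0)//.
  have := hom_bound s e Ke (delta_mx j 0) s0 eP.1.
  have -> : enorm (delta_mx j 0 : 'cV[R[i]]_d) = 1.
    apply/eqP; rewrite -(@eqrXn2 _ 2)// ?enorm_ge0// sqr_enorm (bigD1 j)//=.
    rewrite big1 ?addr0 => [|i ij].
      by rewrite mxE !eqxx ComplexField.Normc.normc1 expr1n.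
    by rewrite mxE (negbTE ij) ComplexField.Normc.normc0 expr0n.
  by rewrite powR1 mulr1; apply: le_trans; exact: ler_norm.
apply: (@le_trans _ _ (\sum_(j < d) (Ke / c * k ^+ n)%:E)%E).
  by apply: lee_sum => j _; exact: Jj.
by rewrite sumEFin lee_fin sumr_const card_ord -[leRHS]mulrA mulr_natl.
Qed.

(** A bound by a multiple of e survives the positive operator T, which multiplies e by k. *)
Lemma iter_transfer_le n K H M f : 0 <= K -> 0 <= H -> holderc a K H f ->
  (forall L, `|f L| <= M * e L) ->
  forall L, `|iter n T f L| <= M * k ^+ n * e L.
Proof.
move=> K0 H0 fP fM; elim: n => [|n ih] L; first by rewrite expr0 mulr1.
have [K' [H' [K'0 H'0 fn]]] := holderc_iter_transfer a01 as2 sm mus n K H f K0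
  H0 fP.
rewrite iterS -lee_fin.
have -> : M * k ^+ n.+1 * e L = M * k ^+ n * (k * hom e (urep L)).
  by rewrite hom_urep exprSr; ring.
rewrite -EFin_integral_hom_eigenfunction.
apply: norm_Rintegral_le.
- exact: (integrable_hom a01 as2 sm mus K' H').
- apply/measurable_EFinP; apply: measurable_funM => //.
  exact: (measurable_hom a01 as2 sm Ke He).
- by move=> v; rewrite lee_fin norm_hom -hom_scale; exact: hom_le.
Qed.

Definition rQ phi L : R := (k * e L)^-1 * T (fun y => phi y * e y) L.

Lemma transferZ K H f c L : 0 <= K -> 0 <= H -> holderc a K H f ->
  T (fun y => c * f y) L = c * T f L.
Proof.
move=> K0 H0 fP; rewrite /transfer -RintegralZl//; last first.
  exact: (integrable_hom a01 as2 sm mus K H).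
by apply: eq_Rintegral => v _; rewrite hom_scale.
Qed.

Lemma holderc_mul_eigenfunction K H phi : holderc a K H phi ->
  holderc a (K * Ke) (H * Ke + K * He) (fun y => phi y * e y).
Proof.
move=> [pK pH]; have [eK eH] := eP; split=> [L|L1 L2].
  by rewrite normrM ler_pM.
have -> : phi L1 * e L1 - phi L2 * e L2 =
  (phi L1 - phi L2) * e L1 + phi L2 * (e L1 - e L2) by ring.
apply: le_trans (ler_normD _ _) _; rewrite !normrM mulrDl; apply: lerD.
  by rewrite mulrAC ler_pM.
by rewrite -mulrA ler_pM.
Qed.

(** [rQ] is k^-1 T conjugated by the multiplication by e, so the intermediate factors e cancel. *)
Lemma iter_rQ n K H phi L : 0 <= K -> 0 <= H -> holderc a K H phi ->
  iter n rQ phi L = (k ^+ n * e L)^-1 * iter n T (fun y => phi y * e y) L.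
Proof.
move=> K0 H0 pP; have fP := holderc_mul_eigenfunction _ _ _ pP.
have Kf0 : 0 <= K * Ke by rewrite mulr_ge0.
have Hf0 : 0 <= H * Ke + K * He by rewrite addr_ge0 ?mulr_ge0.
elim: n L => [|n ih] L.
  by rewrite expr0 mul1r mulrCA mulVf ?mulr1// gt_eqF.
have eE : (fun y => iter n rQ phi y * e y) =
    (fun y => (k ^+ n)^-1 * iter n T (fun z => phi z * e z) y).
  apply/funext => y; rewrite ih invfM mulrAC.
  by rewrite divfK// gt_eqF.
have [K' [H' [K'0 H'0 fn]]] := holderc_iter_transfer a01 as2 sm mus n _ _ _ Kf0
  Hf0 fP.
rewrite !iterS {1}/rQ eE (transferZ K' H')// exprS.
by rewrite mulrA -!invfM; congr (_^-1 * _); ring.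
Qed.

Lemma mpower_wedge2_fin_num n :
  J n (fun w => wedge2_norm w `^ a * opnorm w `^ (s - 2 * a)) \is a fin_num.
Proof.
have [C C0 CP] := mpower_opnorm_le.
rewrite ge0_fin_numE; last first.
  by apply: (mpower_integral_ge0 sfmu) => w; rewrite mulr_ge0 ?powR_ge0.
apply: (@le_lt_trans _ _ (C * k ^+ n)%:E); last exact: ltry.
apply: le_trans (CP n); apply: (le_mpower_integral sfmu).
- exact: measurable_wedge2_powR.
- exact: measurable_opnorm_powR.
- by move=> w; rewrite mulr_ge0 ?powR_ge0.
- by move=> w; apply: wedge2_powR_le.
Qed.

Lemma rQ_estimate : exists A B, [/\ 0 <= A, 0 <= B & forall K H phi n L1 L2,
  0 <= K -> 0 <= H -> holderc a K H phi ->
  `|iter n rQ phi L1| <= K /\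
  `|iter n rQ phi L1 - iter n rQ phi L2| <=
    (A * K + B * (k ^- n * fine (J n (fun w =>
       wedge2_norm w `^ a * opnorm w `^ (s - 2 * a)))) * (K + H)) * pdist L1 L2
         `^ a].
Proof.
have [c c0 ce] := eigenfunction_lower_bound.
have [C C0 CP] := mpower_opnorm_le.
(* In A, the term 2 m Ke C is the integrated |w|^s part of [hbound] and He comes from the variation
   of 1/e; B uses H Ke + K He <= (Ke + He) (K + H). The division by c bounds 1/e. *)
exists ((2 * m%:R * Ke * C + He) / c), ((Ke + He) / c).
split=> [||K H phi n L1 L2 K0 H0 pP].
- by rewrite divr_ge0 ?addr_ge0 ?mulr_ge0// ltW.
- by rewrite divr_ge0 ?addr_ge0// ltW.
have fP := holderc_mul_eigenfunction _ _ _ pP.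
set Kf := K * Ke in fP; set Hf := H * Ke + K * He in fP.
have Kf0 : 0 <= Kf by rewrite mulr_ge0.
have Hf0 : 0 <= Hf by rewrite addr_ge0 ?mulr_ge0.
set W := (J n (fun w => wedge2_norm w `^ a * opnorm w `^ (s - 2 * a))).
have mW := @measurable_wedge2_powR R d s a.
have W0 : (0 <= W)%E.
  by apply: (mpower_integral_ge0 sfmu) => w; rewrite mulr_ge0 ?powR_ge0.
have Wfin : W \is a fin_num by exact: mpower_wedge2_fin_num.
have WE : W = (fine W)%:E by rewrite fineK.
have kn0 : 0 < k ^+ n by rewrite exprn_gt0.
pose G := iter n T (fun y => phi y * e y).
have GE L : iter n rQ phi L = (k ^+ n * e L)^-1 * G L by exact: (iter_rQ n K H).
have Gle L : `|G L| <= K * k ^+ n * e L.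
  apply: (iter_transfer_le n Kf Hf) => // L'.
  by rewrite normrM (ger0_norm (ltW (e0 L'))) ler_wpM2r ?(ltW (e0 L')) ?pP.1.
have keL L : 0 < k ^+ n * e L by rewrite mulr_gt0.
split.
  rewrite GE normrM normfV (gtr0_norm (keL L1)) ler_pdivrMl//.
  by rewrite mulrC mulrA.
have [z z1 zD] := hom_hbound a01 as2 sm Kf Hf _ L1 L2 Kf0 Hf0 fP.
set p := pdist L1 L2 `^ a in zD *.
have p0 : 0 <= p by exact: powR_ge0.
have mB := @measurable_hbound R d s a m Kf Hf.
have B0 w : 0 <= @hbound R d s a m Kf Hf w by exact: hbound_ge0.
have Gdist : `|G L1 - G L2| <= p * (Hf * fine W + Kf * m%:R * 2 * (C * k ^+ n)).
  have := iter_transfer_dist a01 as2 sm mus n Kf Hf _ _ _ (fun w => p * @hbound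
    R d s a m Kf Hf w)
    Kf0 Hf0 fP _ _ zD.
  rewrite (homZ _ _ z)// z1 powR1 mul1r !hom_urep -/G => h.
  rewrite -lee_fin; apply: le_trans (h _ _) _.
  - exact: measurable_funM.
  - by move=> w; rewrite mulr_ge0.
  rewrite (mpower_integralZ sfmu)// EFinM lee_wpmul2l ?lee_fin//.
  rewrite (mpower_integralD sfmu); first last.
  - by move=> w; rewrite mulr_ge0 ?mulr_ge0 ?powR_ge0.
  - by move=> w; rewrite !mulr_ge0 ?powR_ge0.
  - by apply: measurable_funM => //; exact: measurable_opnorm_powR.
  - exact: measurable_funM.
  rewrite !(mpower_integralZ sfmu) -/W ?mulr_ge0//; first last.
  - by move=> w; rewrite mulr_ge0 ?powR_ge0.
  - by move=> w; exact: powR_ge0.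
  - exact: measurable_opnorm_powR.
  rewrite [leRHS]EFinD; apply: leeD; first by rewrite {1}WE EFinM.
  rewrite [leRHS]EFinM; apply: lee_wpmul2l; last exact: CP.
  by rewrite lee_fin !mulr_ge0.
rewrite !GE.
have [eK eH] := eP.
(* The second summand is G L2 / k^n times 1/e(L1) - 1/e(L2), written over a common denominator. *)
have -> : (k ^+ n * e L1)^-1 * G L1 - (k ^+ n * e L2)^-1 * G L2 =
  (k ^+ n * e L1)^-1 * (G L1 - G L2) +
  (k ^+ n * e L1)^-1 * (e L2)^-1 * G L2 * (e L2 - e L1).
  by field; rewrite !gt_eqF.
apply: le_trans (ler_normD _ _) _; rewrite !normrM !normfV.
rewrite !(gtr0_norm (keL _)) (gtr0_norm (e0 _)).
have ec L : (e L)^-1 <= c^-1 by rewrite lef_pV2 ?posrE.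
have first_le : (k ^+ n * e L1)^-1 * `|G L1 - G L2| <=
    c^-1 * (k ^- n * (p * (Hf * fine W + Kf * m%:R * 2 * (C * k ^+ n)))).
  rewrite invfM [X in X * _ <= _]mulrC -[leLHS]mulrA; apply: ler_pM.
  - rewrite invr_ge0; exact: ltW.
  - by rewrite mulr_ge0// invr_ge0 ltW.
  - exact: ec.
  by rewrite ler_wpM2l// invr_ge0 ltW.
have second_le : (k ^+ n * e L1)^-1 * (e L2)^-1 * `|G L2| * `|e L2 - e L1| <=
    c^-1 * (K * (He * p)).
  have : `|e L2 - e L1| <= He * p by rewrite distrC.
  have : (k ^+ n)^-1 * (e L2)^-1 * `|G L2| <= K.
    by rewrite -invfM ler_pdivrMl// mulrC mulrA.
  move=> h1 h2; rewrite invfM.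
  have -> : (k ^+ n)^-1 * (e L1)^-1 * (e L2)^-1 * `|G L2| * `|e L2 - e L1| =
    (e L1)^-1 * (((k ^+ n)^-1 * (e L2)^-1 * `|G L2|) * `|e L2 - e L1|) by ring.
  apply: ler_pM; rewrite ?invr_ge0 ?(ltW (e0 _))//.
    by rewrite !mulr_ge0// invr_ge0 ltW.
  by apply: ler_pM => //; rewrite !mulr_ge0// invr_ge0 ltW.
apply: le_trans (lerD first_le second_le) _.
have fW : 0 <= fine W by exact: fine_ge0.
(* The slack is explicit: (Ke + He) (K + H) exceeds H Ke + K He by Ke K + He H. *)
rewrite -subr_ge0.
have -> : ((2 * m%:R * Ke * C + He) / c * K + (Ke + He) / c * (k ^- n * fine W)
  * (K + H)) * p -
   (c^-1 * (k ^- n * (p * (Hf * fine W + Kf * m%:R * 2 * (C * k ^+ n)))) + c^-1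
     * (K * (He * p)))
  = c^-1 * k ^- n * fine W * p * (Ke * K + He * H).
  by rewrite /Hf /Kf; field; rewrite !gt_eqF.
by rewrite !mulr_ge0 ?addr_ge0 ?mulr_ge0// invr_ge0 ltW.
Qed.

End eigenfunction.

(** * Extended-valued norms and real constants *)

Section holder_norms.
Context {R : realType} {d : nat}.
Implicit Types (f : pspace R d -> R[i]) (L : pspace R d).

Lemma supnorm_le f (K : R) : (forall L, cmod (f L) <= K) -> (supnorm f <= K%:E)%E.
Proof. by move=> fK; apply: ge_ereal_sup => _ [L _ <-]; rewrite lee_fin. Qed.

Lemma hsemi_le (b : R) f (H : R) : 0 < b -> 0 <= H ->
  (forall L1 L2, cmod (f L1 - f L2) <= H * pdist L1 L2 `^ b) ->
  (hsemi b f <= H%:E)%E.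
Proof.
move=> b0 H0 fH; apply: ge_ereal_sup => _ [->|[[L1 L2] /= L12 <-]].
  by rewrite lee_fin.
by rewrite lee_fin ler_pdivrMr ?powR_gt0 ?pdist_gt0.
Qed.

(** The point L0 excludes the value -oo of an empty supremum; both norms are then nonnegative, and a
    finite sum makes each of them finite. *)
Lemma holderP (L0 : pspace R d) (b : R) f : holder b f ->
  exists K H, [/\ 0 <= K, 0 <= H, supnorm f = K%:E & hsemi b f = H%:E] /\
    (forall L, cmod (f L) <= K) /\
    (forall L1 L2, cmod (f L1 - f L2) <= H * pdist L1 L2 `^ b).
Proof.
rewrite /holder /hnorm => fb.
have fS L : ((cmod (f L))%:E <= supnorm f)%E by apply: ereal_sup_ubound; exists L.
have S0 : (0 <= supnorm f)%E by apply: le_trans (fS L0); rewrite lee_fin cmod_ge0.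
have H0 : (0 <= hsemi b f)%E by apply: ereal_sup_ubound; left.
have Sfin : supnorm f \is a fin_num.
  by rewrite ge0_fin_numE//; apply: le_lt_trans fb; rewrite leeDl.
have Hfin : hsemi b f \is a fin_num.
  by rewrite ge0_fin_numE//; apply: le_lt_trans fb; rewrite leeDr.
exists (fine (supnorm f)), (fine (hsemi b f)).
split; first by rewrite ?fine_ge0 ?fineK.
split=> [L|L1 L2].
  by rewrite -lee_fin fineK.
have [->|L12] := eqVneq L1 L2.
  by rewrite subrr ComplexField.Normc.normc0 mulr_ge0 ?powR_ge0 ?fine_ge0.
rewrite -ler_pdivrMr ?powR_gt0 ?pdist_gt0// -lee_fin fineK//.
by apply: ereal_sup_ubound; right; exists (L1, L2).
Qed.

End holder_norms.

(** * Separation of real and imaginary parts *)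

Section complex_operator.
Context {R : realType} {d : nat} {mu : {measure set (Mborel R d) -> \bar R}}.
Context {s : R} {e : pspace R d -> R}.
Implicit Types (phi : pspace R d -> R[i]) (L : pspace R d).

Lemma Gamma_eigenfunction (k : R) :
  (forall L, Gamma mu s (fun y => (e y)%:C) L = k%:C * (e L)%:C) ->
  forall L, @transfer R d mu s e L = k * e L.
Proof.
move=> Ge L; have /(congr1 (@complex.Re R)) := Ge L.
rewrite -rmorphM /= => <-; apply: eq_Rintegral => v _.
rewrite /hom /line /pact; case: insub => [y|] //=.
by rewrite mul0r subr0.
Qed.

Lemma QopE phi L : Qop mu s e phi L =
  @rQ R d mu s e (kfun mu s) (fun y => complex.Re (phi y)) L +i*
  @rQ R d mu s e (kfun mu s) (fun y => complex.Im (phi y)) L.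
Proof.
rewrite /Qop /rQ /cintegral.
have -> : (\int[mu]_v complex.Re (if pact v L is Some y
    then phi y * (e y)%:C * (enorm (v *m urep L) `^ s)%:C else 0)) =
    @transfer R d mu s (fun y => complex.Re (phi y) * e y) L.
  apply: eq_Rintegral => v _; rewrite /hom /line /pact; case: insub => [y|] //=.
  by case: (phi y) => p q /=; ring.
have -> : (\int[mu]_v complex.Im (if pact v L is Some y
    then phi y * (e y)%:C * (enorm (v *m urep L) `^ s)%:C else 0)) =
    @transfer R d mu s (fun y => complex.Im (phi y) * e y) L.
  apply: eq_Rintegral => v _; rewrite /hom /line /pact; case: insub => [y|] //=.
  by case: (phi y) => p q /=; ring.
by apply/eqP; rewrite eq_complex /= !mul0r subr0 addr0 !eqxx.
Qed.

Lemma iter_QopE n phi L : iter n (Qop mu s e) phi L =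
  iter n (@rQ R d mu s e (kfun mu s)) (fun y => complex.Re (phi y)) L +i*
  iter n (@rQ R d mu s e (kfun mu s)) (fun y => complex.Im (phi y)) L.
Proof.
elim: n L => [|n ih] L; first by rewrite /=; case: (phi L).
rewrite !iterS QopE; congr (_ +i* _); congr (@rQ R d mu s e (kfun mu s) _ L);
  by apply/funext => y; rewrite ih.
Qed.

End complex_operator.

(** * The estimate for complex Hoelder functions *)

Theorem lemma4p8 (R : realType) (d : nat) (hd : (0 < d)%N)
    (mu : {measure set (Mborel R d) -> \bar R})
    (sm : R) (sp : \bar R) (hsm : 0 < sm) (hsp : (sm%:E < sp)%E)
    (hmu : forall s : R, sm <= s -> (s%:E <= sp)%E ->
       (\int[mu]_v (opnorm v `^ s)%:E < +oo)%E)
    (hirr : irreducible mu)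
    (s : R) (hs1 : sm < s) (hs2 : (s%:E < sp)%E)
    (e : pspace R d -> R) (he0 : forall x, 0 < e x)
    (he1 : holder (Num.min 1 (s / 2)) (fun x => (e x)%:C))
    (he2 : forall x,
       Gamma mu s (fun y => (e y)%:C) x = (kfun mu s)%:C * (e x)%:C) :
  let a := Num.min (sm / 3) 1 in
  exists A B : R, [/\ 0 <= A, 0 <= B &
    forall phi : pspace R d -> R[i], holder a phi ->
    forall n : nat, (1 <= n)%N ->
      (hnorm a (iter n (Qop mu s e) phi)
         <= A%:E * supnorm phi + B%:E * hfun mu s a n * hnorm a phi)%E].
Proof.
move=> a; set k := kfun mu s in he2 *.
have a0 : 0 < a by rewrite lt_min ltr01 divr_gt0.
have a1 : a <= 1 by rewrite ge_min lexx orbT.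
have a01 : 0 < a <= 1 by rewrite a0.
have as3 : a < s / 3.
  by apply: (@le_lt_trans _ _ (sm / 3)); rewrite ?ge_min ?lexx// ltr_pM2r ?invr_gt0.
have as2 : 2 * a < s by lra.
(* The integer exponent for [powR_sub_le]: it must satisfy s <= m a. *)
pose m := (Num.truncn (s / a)).+1.
have sma : s <= m%:R * a by rewrite -ler_pdivrMr// ltW// truncnS_gt.
have mus := hmu s (ltW hs1) (ltW hs2).
have [L0 _] : exists L : pspace R d, True.
  have [|L [_ _]] := @lineP R d (delta_mx (Ordinal hd) 0); last by exists L.
  apply/negP => /eqP/matrixP/(_ (Ordinal hd) 0)/eqP.
  by rewrite !mxE !eqxx oner_eq0.
have Te := Gamma_eigenfunction k he2.
have [Ke [He [[Ke0 He0 _ _] [eK eH]]]] := holderP L0 _ _ he1.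
have eP : holderc a Ke He e.
  split=> [L|L1 L2]; first by have := eK L; rewrite cmodC.
  have := eH L1 L2; rewrite -rmorphB cmodC => /le_trans; apply.
  (* As distances are at most 1 and a <= min(1, s/2), lowering the exponent to a does not decrease
     the power; at distance 0 both powers vanish. *)
  rewrite ler_wpM2l//; have := pdist_ge0 L1 L2; rewrite le_eqVlt => /predU1P[<-|p0].
    by rewrite !powR0 ?gt_eqF// lt_min ltr01 divr_gt0// (lt_trans hsm).
  apply: ger_powR; first by rewrite p0 pdist_le1.
  by rewrite le_min a1; lra.
(* The sign of the limit is read off the eigenvalue equation: k e(L0) is the integral of a
   nonnegative function. *)
have k_ge0 : 0 <= k.
  rewrite -(pmulr_lge0 _ (he0 L0)) -Te; apply: Rintegral_ge0 => v _.
  by rewrite /hom; case: line => // L; rewrite mulr_ge0 ?powR_ge0 ?(ltW (he0 L)).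
move: k_ge0; rewrite le_eqVlt => /predU1P[k0|k0].
  (* This happens for instance if d = 1 and mu = 0; then Qop = 0, as 0^-1 = 0. *)
  exists 0, 0; split => // phi _ [//|n] _; rewrite !mul0e adde0.
  have Q0 f L : Qop mu s e f L = 0.
    by rewrite /Qop -/k -k0 mul0r invr0 mul0r.
  rewrite -[leRHS]adde0; apply: leeD.
    by apply: supnorm_le => L; rewrite iterS Q0 ComplexField.Normc.normc0.
  apply: hsemi_le => // L1 L2.
  by rewrite iterS !Q0 subrr ComplexField.Normc.normc0 mul0r.
have [A [B [A0 B0 AB]]] := rQ_estimate a01 as2 sma mus Ke0 He0 eP he0 k0 Te.
(* Each factor 2 adds the bounds for the real and the imaginary part; the summand 2 of the first
   constant covers the sup norm of the iterate. *)
exists (2 + 2 * A), (2 * B); split; rewrite ?addr_ge0 ?mulr_ge0//.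
move=> phi phia n _.
have [K [H [[K0 H0 KE HE] [phiK phiH]]]] := holderP L0 _ _ phia.
have Wfin := mpower_wedge2_fin_num a01 as2 sma mus Ke0 He0 eP he0 k0 Te n.
pose h := k ^- n * fine (@mpower_integral R d mu n
  (fun w => wedge2_norm w `^ a * opnorm w `^ (s - 2 * a))).
have hE : hfun mu s a n = h%:E by rewrite /h EFinM fineK.
have h0 : 0 <= h.
  rewrite mulr_ge0 ?invr_ge0 ?exprn_ge0 ?(ltW k0)// fine_ge0//.
  apply: mpower_integral_ge0 => [|w]; last by rewrite mulr_ge0 ?powR_ge0.
  by apply: sfinite_moment mus; lra.
have ReP : holderc a K H (fun y => complex.Re (phi y)).
  split=> [L|L1 L2]; first exact: le_trans (Re_cmod _) (phiK L).
  by rewrite -raddfB; apply: le_trans (Re_cmod _) (phiH L1 L2).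
have ImP : holderc a K H (fun y => complex.Im (phi y)).
  split=> [L|L1 L2]; first exact: le_trans (Im_cmod _) (phiK L).
  by rewrite -raddfB; apply: le_trans (Im_cmod _) (phiH L1 L2).
have ABRe L1 L2 := AB K H _ n L1 L2 K0 H0 ReP.
have ABIm L1 L2 := AB K H _ n L1 L2 K0 H0 ImP.
rewrite /hnorm KE HE hE.
set E := A * K + B * h * (K + H).
have E0 : 0 <= E.
  apply: addr_ge0; first exact: mulr_ge0.
  by apply: mulr_ge0; [exact: mulr_ge0|exact: addr_ge0].
apply: (@le_trans _ _ ((2 * K)%:E + (2 * E)%:E)%E).
  apply: leeD.
    apply: supnorm_le => L; rewrite iter_QopE; apply: le_trans (cmod_ReIm _) _.
    rewrite [leRHS]mulr_natl mulr2n; apply: lerD.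
      exact: (ABRe L L).1.
    exact: (ABIm L L).1.
  apply: hsemi_le => //; first by rewrite mulr_ge0.
  move=> L1 L2; apply: le_trans (cmod_ReIm _) _; rewrite !raddfB !iter_QopE /=.
  rewrite -mulrA mulr_natl mulr2n; apply: lerD.
    exact: (ABRe L1 L2).2.
  exact: (ABIm L1 L2).2.
have : ((2 * K + 2 * E)%:E <= ((2 + 2 * A) * K + 2 * B * h * (K + H))%:E)%E.
  by rewrite lee_fin le_eqVlt; apply/orP; left; apply/eqP; rewrite /E; ring.
exact.
Qed.
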